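(* Let $f:2^{N}\to\mathbb{R}_{\ge 0}$ be a normalized monotone submodular function on a ground set $N$ with $|N|=n$, let $F$ be its multilinear extension, and let $A\in[0,1]^{m\times n}$ be a nonnegative matrix describing $m$ packing constraints such that $Ae_j\le \mathbf{1}$ for every $j\in N$. Consider the multilinear relaxation $$\text{maximize } F(x)\ \text{ s.t. } Ax\le \mathbf{1},\ x\in[0,1]^{N}.$$ There is a parallel/adaptive algorithm for this problem with the following properties, for a given parameter $\varepsilon>0$: (1) it outputs a $(1-1/e-\varepsilon)$-approximation to the multilinear relaxation; (2) it runs in $O\!\left(\frac{1}{\varepsilon^4}\log^2 m\,\log n\right)$ adaptive rounds; (3) it is deterministic if given value oracle access to $F$ and its gradient $\nabla F$, and the total number of oracle queries to $F$ and $\nabla F$ is $O(n\,\mathrm{poly}(\log n/\varepsilon))$; (4) if only given access to a value oracle for $f$, the algorithm is randomized, outputs a $(1-1/e-\varepsilon)$-approximate feasible solution with high probability, deterministically finishes in the prescribed number of rounds, and makes $O(n^2\,\mathrm{poly}(\log n/\varepsilon))$ oracle accesses to $f$.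
   Context: A set function $f:2^N\to\mathbb{R}$ is submodular if $f(A)+f(B)\ge f(A\cup B)+f(A\cap B)$ for all $A,B\subseteq N$, monotone if $S\subseteq T$ implies $f(S)\le f(T)$, and normalized if $f(\emptyset)=0$. The multilinear extension is $F(x)=\sum_{S\subseteq N} f(S)\prod_{i\in S}x_i\prod_{i\notin S}(1-x_i)$ for $x\in[0,1]^N$, i.e. the expectation of $f(R)$ where $R$ contains each $i$ independently with probability $x_i$. $e_j$ is the $j$-th coordinate vector and $\mathbf{1}$ is the all-ones vector. An algorithm with oracle access is $r$-adaptive (runs in $r$ adaptive rounds) if its queries can be partitioned into $r$ rounds so that every query in round $i$ depends only on answers to queries in rounds $1,\dots,i-1$. An $\alpha$-approximation means a solution of value at least $\alpha$ times the optimum value of the relaxation. *)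

(* Defs.v *)
From HB Require Import structures.
From mathcomp Require Export all_boot all_order all_algebra.
From mathcomp Require Export all_classical all_reals all_analysis.

Set Implicit Arguments.
Unset Strict Implicit.
Unset Printing Implicit Defensive.

Export Order.TTheory GRing.Theory Num.Theory.
Export numFieldNormedType.Exports.

Local Open Scope ring_scope.

Section SetFunctions.
Variables (R : realType) (n : nat).
Implicit Types (f : {set 'I_n} -> R) (x : 'cV[R]_n).

Definition submodular f : Prop :=
  forall S T : {set 'I_n}, f (S :|: T) + f (S :&: T) <= f S + f T.

Definition monotone f : Prop :=
  forall S T : {set 'I_n}, S \subset T -> f S <= f T.

Definition normalized f : Prop := f finset.set0 = 0.

Definition in_cube x : bool := [forall i, 0 <= x i 0 <= 1].

Definition multilinear f x : R :=
  \sum_(S : {set 'I_n})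
    f S * ((\prod_(i in S) x i 0) * (\prod_(i in ~: S) (1 - x i 0))).

(* The partial derivatives of the polynomial extending F to the whole space,
   so that they are also meaningful on the boundary of the cube. *)
Definition gradient (F : 'cV[R]_n -> R) x : 'cV[R]_n :=
  \col_i 'D_(delta_mx i 0) F x.

End SetFunctions.

Section Relaxation.
Variables (R : realType) (m n : nat).
Implicit Types (f : {set 'I_n} -> R) (A : 'M[R]_(m, n)) (x : 'cV[R]_n).

Definition le_ones (v : 'cV[R]_m) : bool := [forall i, v i 0 <= 1].

Definition packing_matrix A : Prop :=
  (forall i j, 0 <= A i j <= 1) /\
  (forall j : 'I_n, le_ones (A *m delta_mx j 0)).

Definition feasible A : set 'cV[R]_n :=
  [set x | le_ones (A *m x) /\ in_cube x].

Definition opt f A : R := sup [set multilinear f x | x in feasible A].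

Definition approx_solutions f A (alpha : R) : set 'cV[R]_n :=
  [set x | feasible A x /\ alpha * opt f A <= multilinear f x].

End Relaxation.

(* Algorithms with oracle access, in the query model: internal computation is
   free, and the queries of a round are issued together, hence may depend only
   on the answers (and coins) of the previous rounds.
   [Flip p k] tosses a coin that comes up [true] with probability [p]. *)
Inductive algorithm (R : realType) (Query Answer Out : Type) : Type :=
| Output of Out
| Round of seq Query & (seq Answer -> algorithm R Query Answer Out)
| Flip of {i01 R} & (bool -> algorithm R Query Answer Out).

Section Execution.
Variables (R : realType) (Query Answer Out : Type) (oracle : Query -> Answer).
Local Notation alg := (algorithm R Query Answer Out).

Fixpoint deterministic (a : alg) : Prop :=
  match a with
  | Output _ => True
  | Round _ k => forall answers, deterministic (k answers)
  | Flip _ _ => False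
  end.

(* The number of rounds and of queries are worst-case over the coins. *)
Fixpoint rounds (a : alg) : nat :=
  match a with
  | Output _ => 0%N
  | Round qs k => (rounds (k (map oracle qs))).+1
  | Flip _ k => maxn (rounds (k true)) (rounds (k false))
  end.

Fixpoint queries (a : alg) : nat :=
  match a with
  | Output _ => 0%N
  | Round qs k => (size qs + queries (k (map oracle qs)))%N
  | Flip _ k => maxn (queries (k true)) (queries (k false))
  end.

(* Probability that the output lies in [E]. *)
Fixpoint pr_output (E : set Out) (a : alg) : R :=
  match a with
  | Output x => \1_E x
  | Round qs k => pr_output E (k (map oracle qs))
  | Flip p k =>
      p%:num * pr_output E (k true) + (1 - p%:num) * pr_output E (k false)
  end.

End Execution.

Section Oracles.
Variables (R : realType) (n : nat).

(* F and its gradient can be queried only at points of the cube. *)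
Definition cube_point : Type := {x : 'cV[R]_n | in_cube x}.

(* A query to the gradient asks for a single one of its coordinates. *)
Variant multilinear_query : Type :=
| QueryValue of cube_point
| QueryPartial of cube_point & 'I_n.

Definition multilinear_oracle (f : {set 'I_n} -> R) (q : multilinear_query)
    : R :=
  match q with
  | QueryValue x => multilinear f (\val x)
  | QueryPartial x i => gradient (multilinear f) (\val x) i 0
  end.

End Oracles.

Section Bounds.
Variables (R : realType).

(* [maxn 2] only matters for m < 2 or n < 2, where the logarithms would make
   the bound vanish. *)
Definition rounds_bound (C eps : R) (m n : nat) : R :=
  C * (1 / eps ^+ 4 * ln (maxn 2 m)%:R ^+ 2 * ln (maxn 2 n)%:R).

Definition approx_ratio (eps : R) : R := 1 - 1 / expR 1 - eps.

End Bounds.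

(* Main.v *)
(* Write P for the polytope, g(x) for the gradient of F at x, and OPT for the
   value of the relaxation.  For theta = 1 - p in (0, 1), let u maximize
   sum_j (v_j g_j(x))^p over v in P, and move from x along u until u.g drops
   to a threshold tau.  The first-order condition at u and Hölder's inequality
   show that L := log (N_p / tau), where N_p^p is the value of the maximum,
   contracts to (1 - theta) L + theta^2 log(n) / p.  With the Frank-Wolfe
   choice theta ~ 2 / t this makes max_{v in P} v.g(x) <= (1 + eps) tau after
   O(log n / eps) moves, and from then on tau can decrease by a factor
   1 - O(eps^2 / log n) per move.  A move of length a along u gains at least
   a tau, whereas OPT - F(x) <= max_{v in P} v.g(x), so this is a continuous
   greedy process: after O(log n / eps^2) rounds, independently of m, either
   the total length is 1 and F(x) >= (1 - 1/e - O(eps)) OPT, or tau is a small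
   fraction of OPT and so is OPT - F(x).  The length of a move is found by
   probing a fine grid in a single round, and the initial tau, which must be
   within a constant factor of OPT, by running O(log n) guesses in parallel.
   The analysis tolerates a relative error eps and an additive error
   eps M / n on partial derivatives, M being the largest value of a singleton;
   by Chernoff bounds, n polylog samples of the random set are enough. *)

Require Import Defs.
From mathcomp Require Import ring lra zify.

Set Implicit Arguments.
Unset Strict Implicit.
Unset Printing Implicit Defensive.

Local Open Scope ring_scope.

(** * Power sums over a down-closed polytope *)

(** Young's inequality with exponents 1/(1-p) and 1/p, applied to the two powers. *)
Lemma weighted_amgm (R : realType) (x y p : R) :
  0 <= x -> 0 <= y -> 0 < p < 1 -> x `^ (1 - p) * y `^ p <= (1 - p) * x + p * y.
Proof.
move=> x0 y0 /andP[p0 p1]; have q0 : 0 < 1 - p by lra.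
have := @conjugate_powR R (x `^ (1 - p)) (y `^ p) (1 - p)^-1 p^-1
  (powR_ge0 _ _) (powR_ge0 _ _).
rewrite !invr_gt0 !invrK -!powRrM !mulfV ?gt_eqF// !powRr1// => /(_ q0 p0).
by rewrite subrK (mulrC x) (mulrC y); exact.
Qed.

(** Combines e^z >= 1 + z at z = p ln(1+y) with ln(1+y) >= y/(1+y). It serves as a first-order bound
    whose error is quadratic in y. *)
Lemma powR_1D_ge (R : realType) (y p : R) :
  -1 < y -> 0 < p -> 1 + p * (y / (1 + y)) <= (1 + y) `^ p.
Proof.
move=> y1 p0; have y0 : 0 < 1 + y by lra.
rewrite /powR gt_eqF//; apply: le_trans (expR_ge1Dx _).
rewrite lerD2l ler_pM2l//.
have h : -1 < - (y / (1 + y)).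
  by rewrite ltrN2 ltr_pdivrMr//; lra.
have := le_ln1Dx h.
have -> : 1 - y / (1 + y) = (1 + y)^-1 by field; lra.
by rewrite lnV ?posrE// lerN2.
Qed.

(** A share r <= 1 satisfies r <= r^p; the shares x/(x+y) and y/(x+y) sum to one. *)
Lemma powR_subadd (R : realType) (x y p : R) :
  0 <= x -> 0 <= y -> 0 < p <= 1 -> (x + y) `^ p <= x `^ p + y `^ p.
Proof.
move=> x0 y0 /andP[p0 p1].
have [xy0|xy0] := eqVneq (x + y) 0.
  by rewrite xy0 powR0 ?gt_eqF// addr_ge0 ?powR_ge0.
have {}xy0 : 0 < x + y by rewrite lt_neqAle eq_sym xy0 addr_ge0.
have frac z : 0 <= z -> z <= x + y -> z / (x + y) * (x + y) `^ p <= z `^ p.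
  rewrite le_eqVlt => /predU1P[<-|z0] zxy.
    by rewrite !mul0r powR_ge0.
  have -> : z `^ p = (z / (x + y)) `^ p * (x + y) `^ p.
    by rewrite -powRM ?divr_ge0 ?ltW// divfK ?gt_eqF.
  rewrite ler_wpM2r ?powR_ge0// ger1_powR//.
  by rewrite divr_gt0//= ler_pdivrMr// mul1r.
apply: le_trans (lerD (frac x _ _) (frac y _ _)) => //; try lra.
by rewrite -mulrDl -mulrDl divff ?gt_eqF// mul1r.
Qed.

Lemma continuous_powR_norm (R : realType) (p : R) :
  0 < p <= 1 -> continuous (fun x : R => `|x| `^ p).
Proof.
move=> /andP[p0 p1] x.
have near_ge (a b : R) : `|a| `^ p - `|b| `^ p <= `|a - b| `^ p.
  rewrite lerBlDr; apply: le_trans (powR_subadd _ _ _) => //; last by rewrite p0.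
  by rewrite ge0_ler_powR ?nnegrE ?addr_ge0 ?(ltW p0)// -{1}[a](subrK b) ler_normD.
apply/cvgrPdist_lt => e e0.
have d0 : 0 < e `^ p^-1 by exact: powR_gt0.
apply: filterS (nbhsx_ballx x _ d0) => y xy.
suff : `|x - y| `^ p < e.
  apply: le_lt_trans; rewrite ler_norml.
  by rewrite near_ge andbT lerNl opprB [`|x - y|]distrC near_ge.
rewrite -[ltRHS](@powRr1 _ e) ?ltW// -(mulVf (lt0r_neq0 p0)) powRrM.
by rewrite gt0_ltr_powR ?nnegrE ?powR_ge0.
Qed.

Definition power_sum (R : realType) n (p : R) (g u : 'cV[R]_n) : R :=
  \sum_j (u j 0 * g j 0) `^ p.

Section PowerSum.
Variables (R : realType) (n : nat).
Implicit Types (g u v : 'cV[R]_n) (p : R).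

Definition nneg g := forall j, 0 <= g j 0.

(** Each term b is at most K, so b^p' <= b^p K^(p'-p). This lets the exponent grow along a run, and
    at p' = 1 it turns a power-sum bound into a linear one. *)
Lemma power_sum_monotone_exponent (p p' K : R) g v :
  nneg g -> nneg v -> 0 < p <= p' -> 0 < K ->
  power_sum p g v <= K `^ p -> power_sum p' g v <= K `^ p'.
Proof.
move=> g0 v0 /andP[p0 pp'] K0 H.
have b0 j : 0 <= v j 0 * g j 0 by rewrite mulr_ge0.
have bK j : v j 0 * g j 0 <= K.
  rewrite leNgt; apply/negP => Kb.
  have := gt0_ltr_powR p0 (ltW K0) (b0 j) Kb; rewrite ltNge => /negP; apply.
  apply: le_trans H; rewrite /power_sum (bigD1 j)//= lerDl sumr_ge0// => i _.
  exact: powR_ge0.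
have -> : K `^ p' = K `^ p * K `^ (p' - p).
  by rewrite -powRD ?(addrC p) ?subrK// (gt_eqF K0) implybT.
apply: (@le_trans _ _ (power_sum p g v * K `^ (p' - p))); last first.
  by rewrite ler_wpM2r ?powR_ge0.
rewrite /power_sum mulr_suml; apply: ler_sum => j _.
have [->|bj0] := eqVneq (v j 0 * g j 0) 0.
  by rewrite !powR0 ?mul0r// gt_eqF// (lt_le_trans p0).
have -> : (v j 0 * g j 0) `^ p' = (v j 0 * g j 0) `^ p * (v j 0 * g j 0) `^ (p' - p).
  by rewrite -powRD ?(addrC p) ?subrK// bj0 implybT.
by rewrite ler_wpM2l ?powR_ge0// ge0_ler_powR ?nnegrE ?subr_ge0// ltW.
Qed.

(** * Maximizers of power sums and their first-order condition *)

Definition power_maximizer (P : set 'cV[R]_n) p g u :=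
  P u /\ forall v, P v -> power_sum p g v <= power_sum p g u.

Section Maximizer.
Variable P : set 'cV[R]_n.
Hypothesis P_nneg : forall v, P v -> nneg v.
Hypothesis P_convex : forall u v (h : R), P u -> P v -> 0 <= h <= 1 ->
  P ((1 - h) *: u + h *: v).
Hypothesis P_delta : forall j, P (delta_mx j 0).

(** If u_j = 0, moving a fraction h towards the j-th unit vector gains order h^p in coordinate j and
    loses at most order h elsewhere; since p < 1 the gain wins for small h. *)
Lemma power_maximizer_pos p g u : 0 < p < 1 -> nneg g ->
  power_maximizer P p g u -> forall j, 0 < g j 0 -> 0 < u j 0.
Proof.
move=> /andP[p0 p1] g0 [Pu umax] j gj0.
rewrite lt_neqAle (P_nneg Pu) andbT; apply/negP => /eqP uj0.
pose A := power_sum p g u.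
have A0 : 0 <= A by apply: sumr_ge0 => i _; exact: powR_ge0.
have q0 : 0 < 1 - p by lra.
have key (h : R) : 0 < h <= 1 -> (g j 0) `^ p <= h `^ (1 - p) * A.
  move=> /andP[h0 h1].
  have hh : 0 <= h <= 1 by rewrite ltW.
  have := umax _ (P_convex Pu (P_delta j) hh).
  rewrite -/A {1}/power_sum (bigD1 j)//= !mxE -uj0 mulr0 add0r !eqxx mulr1.
  rewrite powRM//; last exact: ltW.
  have : (1 - h) * A <= \sum_(i < n | i != j)
      ((((1 - h) *: u + h *: delta_mx j 0) i 0) * g i 0) `^ p.
    rewrite /A /power_sum (bigD1 j)//= -uj0 mul0r powR0 ?gt_eqF// add0r mulr_sumr.
    apply: ler_sum => i ij; rewrite !mxE (negbTE ij) /= mulr0 addr0 -mulrA.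
    have ui := P_nneg Pu i.
    have [->|h1'] := eqVneq h 1; first by rewrite subrr !mul0r powR_ge0.
    have hlt : h < 1 by rewrite lt_neqAle h1'.
    rewrite [leRHS]powRM ?subr_ge0 ?mulr_ge0//.
    rewrite ler_wpM2r ?powR_ge0// ger1_powR//; last exact: ltW.
    by apply/andP; split; lra.
  move=> H1 H2.
  have H3 : h `^ p * (g j 0) `^ p <= h * A by lra.
  rewrite -(ler_pM2l (powR_gt0 p h0)); apply: le_trans H3 _.
  rewrite mulrA -powRD; last by rewrite (gt_eqF h0) implybT.
  by rewrite (addrC p) subrK powRr1 ?(ltW h0).
pose c := (g j 0) `^ p.
have c0 : 0 < c by exact: powR_gt0.
(* With h = t^(1/(1-p)) the bound [key] reads c <= t A, which t <= c/(2A+1) contradicts. *)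
pose t := Num.min 1 (c / (A + A + 1)).
have t0 : 0 < t by rewrite lt_min ltr01 divr_gt0//; lra.
have h0 : 0 < t `^ (1 - p)^-1 by exact: powR_gt0.
have h1 : t `^ (1 - p)^-1 <= 1.
  have t1 : t <= 1 by rewrite ge_min lexx.
  rewrite -[leRHS](_ : 1 `^ (1 - p)^-1 = 1); last by rewrite powR1.
  by rewrite ge0_ler_powR ?nnegrE ?invr_ge0// ltW.
have := key (t `^ (1 - p)^-1); rewrite h0 h1 => /(_ isT).
rewrite -powRrM mulVf ?gt_eqF// powRr1 ?(ltW t0)//.
rewrite -/c leNgt => /negP; apply.
apply: (@le_lt_trans _ _ (c / (A + A + 1) * A)).
  by rewrite ler_wpM2r// ge_min lexx orbT.
rewrite mulrAC ltr_pdivrMr; last lra.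
rewrite ltr_pM2l//; lra.
Qed.

(** The derivative of the power sum at u towards v is at most 0. Where g_j > 0 the quotient is
    meaningful because u_j > 0; where g_j = 0 the first factor of the term vanishes. *)
Lemma power_maximizer_first_order p g u v : 0 < p < 1 -> nneg g ->
  power_maximizer P p g u -> P v ->
  \sum_j (u j 0 * g j 0) `^ p * (v j 0 / u j 0) <= power_sum p g u.
Proof.
move=> p01 g0 umaxi Pv; have [p0 p1] := andP p01.
have [Pu umax] := umaxi.
pose a j := (u j 0 * g j 0) `^ p.
have a0 j : 0 <= a j by exact: powR_ge0.
have aE j : a j = 0 \/ 0 < u j 0.
  have [gj|gj] := eqVneq (g j 0) 0.
    by left; rewrite /a gj mulr0 powR0 ?gt_eqF.
  right; apply: (power_maximizer_pos p01 g0 umaxi).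
  by rewrite lt_neqAle eq_sym gj g0.
pose z j := v j 0 / u j 0 - 1.
pose S := \sum_j a j * z j.
pose Q := \sum_j a j * z j ^+ 2.
have Q0 : 0 <= Q by apply: sumr_ge0 => j _; rewrite mulr_ge0// sqr_ge0.
suff S0 : S <= 0.
  rewrite -subr_le0 /power_sum -sumrB; move: S0; rewrite /S.
  by under eq_bigr do rewrite /z mulrBr mulr1.
(* A finite-difference form of S <= 0: along the segment the expansion has a second-order error,
   controlled by Q. *)
have key (h : R) : 0 < h <= 2^-1 -> S <= h * (2 * Q).
  move=> /andP[h0 h1].
  have hh : 0 <= h <= 1 by apply/andP; split; lra.
  have := umax _ (P_convex Pu Pv hh).
  have : power_sum p g u + p * h * (S - h * (2 * Q)) <=
         power_sum p g ((1 - h) *: u + h *: v).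
    rewrite /power_sum /S /Q !mulr_sumr -sumrB mulr_sumr -big_split /=.
    apply: ler_sum => j _; rewrite -/(a j) !mxE.
    have [->|uj0] := aE j; first by rewrite !mul0r !mulr0 subrr mulr0 addr0 powR_ge0.
    have vj0 := P_nneg Pv j.
    have zj : -1 <= z j by rewrite /z lerBrDl subrr divr_ge0 ?(ltW uj0).
    have hz : - h <= h * z j by rewrite -mulrN1 ler_wpM2l// ltW.
    have -> : ((1 - h) * u j 0 + h * v j 0) * g j 0 = (u j 0 * g j 0) * (1 + h * z j).
      rewrite /z; field; lra.
    rewrite powRM ?mulr_ge0 ?(ltW uj0)//; last lra.
    rewrite -/(a j).
    have -> : a j + p * h * (a j * z j - h * (2 * (a j * z j ^+ 2))) =
              a j * (1 + p * (h * z j - 2 * (h * z j) ^+ 2)) by ring.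
    rewrite ler_wpM2l//; apply: le_trans (powR_1D_ge _ _) => //; last lra.
    rewrite lerD2l ler_pM2l//; set w := h * z j.
    have w1 : - 2^-1 <= w by rewrite /w; lra.
    have w0 : 0 < 1 + w by lra.
    rewrite ler_pdivlMr// -subr_ge0.
    have -> : w - (w - 2 * w ^+ 2) * (1 + w) = w ^+ 2 * (1 + 2 * w) by ring.
    by rewrite mulr_ge0 ?sqr_ge0//; lra.
  move=> H1 H2.
  have : p * h * (S - h * (2 * Q)) <= 0 by lra.
  by rewrite pmulr_rle0 ?mulr_gt0// subr_le0.
rewrite leNgt; apply/negP => S0.
pose h := Num.min 2^-1 (S / (4 * Q + 1)).
have h0 : 0 < h by rewrite lt_min divr_gt0 ?andbT//; lra.
have := key h; rewrite h0 ge_min lexx /= => /(_ isT); rewrite leNgt => /negP; apply.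
apply: (@le_lt_trans _ _ (S / (4 * Q + 1) * (2 * Q))).
  by rewrite ler_wpM2r ?mulr_ge0// ge_min lexx orbT.
by rewrite mulrAC ltr_pdivrMr ?ltr_pM2l//; lra.
Qed.

(* Hölder's inequality between the new gradient along u and the first-order
   condition at u: decreasing the inner product with u forces the power-sum
   norm of the gradient on all of P to decrease. *)
Lemma power_maximizer_decrease p g g' u (tau L Lam : R) :
  0 < p < 1 -> nneg g -> nneg g' -> (forall j, g' j 0 <= g j 0) ->
  0 < tau -> n%:R <= expR Lam ->
  power_maximizer P p g u ->
  power_sum p g u <= (tau * expR L) `^ p ->
  \sum_j u j 0 * g' j 0 <= tau ->
  forall v, P v -> power_sum p g' v <=
    (tau * expR (p * L + (1 - p) ^+ 2 / p * Lam)) `^ p.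
Proof.
move=> p01 g0 g'0 gg' tau0 nLam umaxi HA HB v Pv; have [p0 p1] := andP p01.
have [Pu umax] := umaxi.
have q0 : 0 < 1 - p by lra.
have u0 := P_nneg Pu.
have v0 := P_nneg Pv.
pose a j := (u j 0 * g j 0) `^ p.
pose b j := (u j 0 * g' j 0) `^ p.
have b0 j : 0 <= b j by exact: powR_ge0.
(* Weighted AM-GM at the scale t bounds the sum of [b] by t^p e^Lam = B0: the power-mean inequality
   with n replaced by e^Lam. *)
pose t := tau * expR (- Lam).
have t0 : 0 < t by rewrite mulr_gt0 ?expR_gt0.
pose B0 := tau `^ p * expR ((1 - p) * Lam).
have B00 : 0 < B0 by rewrite mulr_gt0 ?powR_gt0 ?expR_gt0.
have Bb : \sum_j b j <= B0.
  have step j : b j <= t `^ p * ((1 - p) + p * (u j 0 * g' j 0 / t)).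
    have := @weighted_amgm R 1 (u j 0 * g' j 0 / t) p ler01 _ p01.
    rewrite powR1 mul1r mulr1 => H.
    rewrite /b -{1}[u j 0 * g' j 0](divfK (lt0r_neq0 t0)) mulrC.
    rewrite powRM; [|exact: ltW|by rewrite divr_ge0 ?mulr_ge0// ltW].
    by rewrite ler_wpM2l ?powR_ge0// H// divr_ge0 ?mulr_ge0// ltW.
  apply: le_trans (ler_sum _ (fun j _ => step j)) _.
  rewrite -mulr_sumr big_split /= sumr_const card_ord -mulr_sumr -mulr_suml.
  have -> : B0 = t `^ p * expR Lam.
    rewrite /B0 /t powRM ?expR_ge0 ?(ltW tau0)// -expRM -mulrA -expRD.
    by congr (_ * expR _); ring.
  rewrite ler_wpM2l ?powR_ge0//.
  have : (\sum_i u i 0 * g' i 0) / t <= expR Lam.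
    rewrite ler_pdivrMr// /t mulrCA -expRD subrr expR0 mulr1//.
  move=> H; rewrite -[in X in X + _]mulr_natr.
  have : (1 - p) * n%:R <= (1 - p) * expR Lam by rewrite ler_pM2l.
  have : p * ((\sum_i u i 0 * g' i 0) / t) <= p * expR Lam by rewrite ler_pM2l.
  lra.
pose A0 := (tau * expR L) `^ p.
have A00 : 0 < A0 by rewrite powR_gt0// mulr_gt0// expR_gt0.
(* This c gives c * B0 = A0, so both sums coming from [term] have the same bound and the total is
   A0^p B0^(1-p), as in Hölder's inequality. *)
pose c := A0 / B0.
have c0 : 0 < c by rewrite divr_gt0.
have term j : (v j 0 * g' j 0) `^ p <=
    c `^ (p - 1) * ((1 - p) * (c * b j) + p * (a j * (v j 0 / u j 0))).
  have rhs0 : 0 <= c `^ (p - 1) * ((1 - p) * (c * b j) + p * (a j * (v j 0 / u j 0))).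
    apply: mulr_ge0; first exact: powR_ge0.
    apply: addr_ge0; apply: mulr_ge0; try exact: ltW.
      by apply: mulr_ge0; [exact: ltW|exact: powR_ge0].
    by apply: mulr_ge0; [exact: powR_ge0|exact: divr_ge0].
  have [gj|gj] := eqVneq (g j 0) 0.
    have -> : g' j 0 = 0 by apply/eqP; rewrite eq_le g'0 andbT -gj gg'.
    by rewrite mulr0 powR0 ?gt_eqF.
  have {}gj : 0 < g j 0 by rewrite lt_neqAle eq_sym gj g0.
  have uj := power_maximizer_pos p01 g0 umaxi gj.
  pose s := (g' j 0 / g j 0) `^ p.
  have s0 : 0 <= s by exact: powR_ge0.
  have s1 : s <= 1.
    rewrite -[leRHS](_ : 1 `^ p = 1); last by rewrite powR1.
    rewrite ge0_ler_powR ?nnegrE ?divr_ge0 ?(ltW p0) ?(ltW gj)//.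
    by rewrite ler_pdivrMr// mul1r.
  have bE : b j = a j * s.
    rewrite /b /a /s -powRM ?mulr_ge0 ?invr_ge0 ?(ltW gj)//; congr (_ `^ p); field; lra.
  have -> : (v j 0 * g' j 0) `^ p = a j * (s * (v j 0 / u j 0) `^ p).
    rewrite mulrA -bE /b -powRM ?mulr_ge0 ?invr_ge0 ?(ltW uj)//.
    congr (_ `^ p); field; lra.
  have r0 : 0 <= v j 0 / u j 0 by rewrite divr_ge0// ?(ltW uj).
  rewrite bE [X in _ <= X](_ : _ = a j *
    (c `^ (p - 1) * ((1 - p) * (c * s) + p * (v j 0 / u j 0)))); last by ring.
  rewrite ler_wpM2l ?powR_ge0//.
  have := @weighted_amgm R (c * s) (v j 0 / u j 0) p _ r0 p01.
  rewrite mulr_ge0 ?(ltW c0)// => /(_ isT) H.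
  rewrite -(ler_pM2l (powR_gt0 (1 - p) c0)).
  rewrite [leRHS]mulrA -powRD ?(gt_eqF c0) ?implybT//.
  rewrite (_ : 1 - p + (p - 1) = 0) ?powRr0 ?mul1r; last by ring.
  apply: le_trans H; rewrite [leLHS]mulrA ler_wpM2r ?powR_ge0//.
  rewrite powRM ?(ltW c0)// ler_wpM2l ?powR_ge0//.
  (* What remains is s <= s^(1-p), true because 0 <= s <= 1. *)
  have [->|s00] := eqVneq s 0; first exact: powR_ge0.
  apply: ger1_powR; last by lra.
  by rewrite s1 andbT lt_neqAle eq_sym s00.
apply: le_trans (ler_sum _ (fun j _ => term j)) _.
rewrite -mulr_sumr big_split /= -!mulr_sumr.
have H1 := le_trans (power_maximizer_first_order p01 g0 umaxi Pv) HA.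
have cB : c * B0 = A0 by rewrite /c divfK ?gt_eqF.
apply: (@le_trans _ _ (c `^ (p - 1) * A0)).
  rewrite ler_wpM2l ?powR_ge0//.
  have h1 : (1 - p) * (c * \sum_j b j) <= (1 - p) * A0.
    by rewrite -cB !ler_pM2l.
  have h2 : p * (\sum_j a j * (v j 0 / u j 0)) <= p * A0 by rewrite ler_pM2l.
  lra.
rewrite le_eqVlt; apply/orP; left; apply/eqP.
rewrite /c /B0 /A0 !(@powRM _ tau) ?expR_ge0 ?(ltW tau0)// -!expRM.
have -> : tau `^ p * expR (L * p) / (tau `^ p * expR ((1 - p) * Lam)) =
  expR (L * p - (1 - p) * Lam).
  rewrite expRD expRN; field; rewrite !gt_eqF ?expR_gt0 ?powR_gt0//.
rewrite -!expRM mulrCA -expRD; congr (_ * expR _); field; lra.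
Qed.

End Maximizer.
End PowerSum.

(** * The multilinear extension *)

Section MultilinearExtension.
Variables (R : realType) (n : nat).
Implicit Types (f g : {set 'I_n} -> R) (x y : 'cV[R]_n) (i : 'I_n) (S T : {set 'I_n}).

(** Adding i on one side and removing it on the other makes the value independent of whether i lies
    in S. *)
Definition marginal i f S : R := f (i |: S) - f (S :\ i).

Definition update x i (t : R) : 'cV[R]_n := \col_j (if j == i then t else x j 0).

Definition indicator S : 'cV[R]_n := \col_j (j \in S)%:R.

Definition weight x S : R := \prod_k (if k \in S then x k 0 else 1 - x k 0).

Lemma multilinearE f x : multilinear f x = \sum_S f S * weight x S.
Proof.
apply: eq_bigr => S _; congr (_ * _).
rewrite /weight [RHS](bigID (mem S)) /=; congr (_ * _).
  by apply: eq_bigr => k ->.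
apply: eq_big => k; first by rewrite !inE.
by rewrite inE => /negbTE ->.
Qed.

Lemma weight_ge0 x S : in_cube x -> 0 <= weight x S.
Proof.
move=> /forallP xc; apply: prodr_ge0 => k _.
by have /andP[x0 x1] := xc k; case: ifP => _ //; rewrite subr_ge0.
Qed.

Lemma weight_update x i t S :
  weight (update x i t) S =
  (if i \in S then t else 1 - t) * \prod_(k | k != i) (if k \in S then x k 0 else 1 - x k 0).
Proof.
rewrite /weight (bigD1 i)//= !mxE eqxx; congr (_ * _).
by apply: eq_bigr => k ki; rewrite !mxE (negbTE ki).
Qed.

Lemma update_id x i : update x i (x i 0) = x.
Proof. by apply/matrixP => j k; rewrite ord1 mxE; case: eqP => [->|]. Qed.

Lemma multilinear_update f x i t :
  multilinear f (update x i t) =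
  t * multilinear f (update x i 1) + (1 - t) * multilinear f (update x i 0).
Proof.
rewrite !multilinearE !mulr_sumr -big_split /=; apply: eq_bigr => S _.
rewrite !weight_update; case: ifP => _; ring.
Qed.

Lemma multilinearB f g x :
  multilinear (fun S => f S - g S) x = multilinear f x - multilinear g x.
Proof. by rewrite !multilinearE -sumrB; apply: eq_bigr => S _; rewrite mulrBl. Qed.

Lemma multilinearN f x : multilinear (fun S => - f S) x = - multilinear f x.
Proof. by rewrite !multilinearE -sumrN; apply: eq_bigr => S _; rewrite mulNr. Qed.

Lemma multilinearZ (a : R) f x :
  multilinear (fun S => a * f S) x = a * multilinear f x.
Proof. by rewrite !multilinearE mulr_sumr; apply: eq_bigr => S _; rewrite mulrA. Qed.

Lemma multilinear_le f g x : in_cube x -> (forall S, f S <= g S) ->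
  multilinear f x <= multilinear g x.
Proof.
move=> xc fg; rewrite !multilinearE; apply: ler_sum => S _.
by rewrite ler_wpM2r// weight_ge0.
Qed.

(** On the right only sets containing i have nonzero weight; each collects the weights of S and of S
    without i from the left. *)
Lemma multilinear_setU1 f x i :
  multilinear (fun S => f (i |: S)) x = multilinear f (update x i 1).
Proof.
rewrite !multilinearE [LHS](bigID (fun S : {set 'I_n} => i \in S)) /=.
rewrite [RHS](bigID (fun S : {set 'I_n} => i \in S)) /=.
rewrite [X in _ = _ + X]big1 ?addr0; last first.
  by move=> S iS; rewrite weight_update (negbTE iS) subrr mul0r mulr0.
rewrite [X in _ + X = _](reindex_onto (fun S => S :\ i) (fun S => i |: S)) /=; last first.
  by move=> S iS; apply/setP => k; rewrite !inE; case: eqP => // ->; rewrite (negbTE iS).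
rewrite [X in _ + X = _](eq_bigl (fun S : {set 'I_n} => i \in S)); last first.
  move=> S; rewrite !inE eqxx /=; apply/eqP/idP => [<-|iS]; first by rewrite !inE eqxx.
  by rewrite finset.setD1K.
rewrite -big_split /=; apply: eq_bigr => S iS.
rewrite finset.setD1K// (_ : i |: S = S); last by apply/finset.setUidPr; rewrite finset.sub1set.
rewrite -mulrDr; congr (_ * _).
rewrite -{1 2}(update_id x i) !weight_update iS !inE eqxx /=.
have -> : \prod_(k < n | k != i) (if k \in S :\ i then x k 0 else 1 - x k 0) =
  \prod_(k < n | k != i) (if k \in S then x k 0 else 1 - x k 0).
  by apply: eq_bigr => k ki; rewrite !inE ki.
ring.
Qed.

Lemma multilinear_setD1 f x i :
  multilinear (fun S => f (S :\ i)) x = multilinear f (update x i 0).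
Proof.
rewrite !multilinearE [LHS](bigID (fun S : {set 'I_n} => i \notin S)) /=.
rewrite [RHS](bigID (fun S : {set 'I_n} => i \notin S)) /=.
rewrite [X in _ = _ + X]big1 ?addr0; last first.
  by move=> S; rewrite negbK => iS; rewrite weight_update iS mul0r mulr0.
rewrite [X in _ + X = _](reindex_onto (fun S => i |: S) (fun S => S :\ i)) /=; last first.
  by move=> S; rewrite negbK => iS; rewrite finset.setD1K.
rewrite [X in _ + X = _](eq_bigl (fun S : {set 'I_n} => i \notin S)); last first.
  move=> S; rewrite !inE eqxx /=; apply/eqP/idP => [<-|iS]; first by rewrite !inE eqxx.
  by rewrite finset.setU1K.
rewrite -big_split /=; apply: eq_bigr => S iS.
rewrite finset.setU1K// (_ : S :\ i = S); last first.
  by apply/finset.setDidPl; rewrite disjoint_sym disjoints1.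
rewrite -mulrDr; congr (_ * _).
rewrite -{1 2}(update_id x i) !weight_update (negbTE iS) !inE eqxx /=.
have -> : \prod_(k < n | k != i) (if k \in i |: S then x k 0 else 1 - x k 0) =
  \prod_(k < n | k != i) (if k \in S then x k 0 else 1 - x k 0).
  by apply: eq_bigr => k ki; rewrite !inE (negbTE ki).
ring.
Qed.

Lemma multilinear_updateB f x i s t :
  multilinear f (update x i t) - multilinear f (update x i s) =
  (t - s) * multilinear (marginal i f) x.
Proof.
rewrite /marginal multilinearB multilinear_setU1 multilinear_setD1.
rewrite multilinear_update [in X in _ - X]multilinear_update; ring.
Qed.

Lemma multilinear_indicator f S : multilinear f (indicator S) = f S.
Proof.
rewrite multilinearE (bigD1 S)//= big1 => [|T TS]; last first.
  have [k kTS] : exists k, (k \in T) != (k \in S).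
    apply/existsP; rewrite -negb_forall; apply: contra TS => /forallP H.
    by apply/eqP/setP => k; have /eqP := H k.
  rewrite /weight (bigD1 k)//= mxE; move: kTS.
  by case: (k \in T); case: (k \in S) => //; rewrite ?subrr mul0r mulr0.
rewrite /weight big1 ?mulr1 ?addr0// => k _; rewrite mxE.
by case: (k \in S) => //; rewrite subr0.
Qed.

(** A path from x to y that changes one coordinate at a time, so that differences of the extension
    follow from its affinity in each coordinate, without integrals. *)
Definition hybrid x y (k : nat) : 'cV[R]_n := \col_j (if (j < k)%N then y j 0 else x j 0).

Lemma multilinear_telescope f x y :
  multilinear f y - multilinear f x =
  \sum_i (y i 0 - x i 0) * multilinear (marginal i f) (hybrid x y i).
Proof.
have -> : y = hybrid x y n.
  by apply/matrixP => j k; rewrite ord1 mxE ltn_ord.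
rewrite [in LHS](_ : multilinear f x = multilinear f (hybrid x y 0)); last first.
  by congr multilinear; apply/matrixP => j k; rewrite ord1 mxE ltn0.
rewrite -(@telescope_sumr _ 0 n (fun k => multilinear f (hybrid x y k)))//.
rewrite big_mkord; apply: eq_bigr => i _.
have -> : hybrid x (hybrid x y n) i = hybrid x y i.
  by apply/matrixP => j k; rewrite ord1 !mxE; case: ifP => // ji; rewrite ltn_ord.
rewrite -multilinear_updateB.
rewrite (_ : update _ i (hybrid x y n i 0) = hybrid x y i.+1); last first.
  apply/matrixP => j k; rewrite ord1 !mxE ltnS ltn_ord.
  by have [->|ji] := eqVneq j i; rewrite ?leqnn// [in RHS]leq_eqVlt (inj_eq (@ord_inj n)) (negbTE ji).
rewrite (_ : update _ i (x i 0) = hybrid x y i)//.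
by apply/matrixP => j k; rewrite ord1 !mxE; have [->|ji] := eqVneq j i; rewrite ?ltnn.
Qed.

(** The weights sum to 1: a constant has zero marginals, so telescoping reduces to the value at the
    empty set. *)
Lemma multilinear_cst (c : R) x : multilinear (fun=> c) x = c.
Proof.
rewrite -[RHS](multilinear_indicator (fun=> c) finset.set0).
apply/eqP; rewrite -subr_eq0 multilinear_telescope big1// => i _.
rewrite (_ : marginal i _ = fun=> 0); first by rewrite multilinearE big1 ?mulr0// => S; rewrite mul0r.
by apply/funext => S; rewrite /marginal subrr.
Qed.

Lemma multilinear_ge0 f x : in_cube x -> (forall S, 0 <= f S) -> 0 <= multilinear f x.
Proof. by move=> xc f0; rewrite -(multilinear_cst 0 x) multilinear_le. Qed.

Lemma hybrid_cube x y k : in_cube x -> in_cube y -> in_cube (hybrid x y k).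
Proof.
by move=> /forallP xc /forallP yc; apply/forallP => j; rewrite !mxE; case: ifP.
Qed.

Definition le_vec x y := forall i, x i 0 <= y i 0.

Lemma le_hybrid x y k : le_vec x y -> le_vec x (hybrid x y k).
Proof. by move=> xy i; rewrite !mxE; case: ifP. Qed.

Lemma hybrid_le x y k : le_vec x y -> le_vec (hybrid x y k) y.
Proof. by move=> xy i; rewrite !mxE; case: ifP. Qed.

Lemma marginal_ge0 i f S : monotone f -> 0 <= marginal i f S.
Proof.
move=> fm; rewrite subr_ge0; apply: fm.
by apply: fintype.subset_trans (finset.subsetDl _ _) _; exact: finset.subsetUr.
Qed.

Lemma multilinear_monotone f x y : monotone f -> in_cube x -> in_cube y ->
  le_vec x y -> multilinear f x <= multilinear f y.
Proof.
move=> fm xc yc xy; rewrite -subr_ge0 multilinear_telescope sumr_ge0// => i _.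
rewrite mulr_ge0 ?subr_ge0// multilinear_ge0 ?hybrid_cube// => S.
exact: marginal_ge0.
Qed.

(** Submodularity for [i |: S] and [T :\ i], whose union and intersection are [i |: T] and
    [S :\ i]. *)
Lemma marginal_antitone i f S T : submodular f -> S \subset T ->
  marginal i f T <= marginal i f S.
Proof.
move=> fs ST; have := fs (i |: S) (T :\ i).
have -> : (i |: S) :|: (T :\ i) = i |: T.
  apply/setP => k; rewrite !inE; case: eqP => //= _.
  by have [kS|//] := boolP (k \in S); rewrite (fintype.subsetP ST).
have -> : (i |: S) :&: (T :\ i) = S :\ i.
  apply/setP => k; rewrite !inE; case: eqP => //= _.
  by have [kS|//] := boolP (k \in S); rewrite (fintype.subsetP ST).
rewrite /marginal; lra.
Qed.

(** The partial derivative of the extension, by [gradientE], written as an expected marginal so that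
    it inherits bounds from [f] directly. *)
Definition grad f x i : R := multilinear (marginal i f) x.

Lemma grad_antitone f x y i : submodular f -> in_cube x -> in_cube y ->
  le_vec x y -> grad f y i <= grad f x i.
Proof.
move=> fs xc yc xy; rewrite -lerN2 /grad -!multilinearN.
by apply: multilinear_monotone => // S T ST; rewrite lerN2 marginal_antitone.
Qed.

Lemma grad_ge0 f x i : monotone f -> in_cube x -> 0 <= grad f x i.
Proof. by move=> fm xc; apply: multilinear_ge0 => // S; exact: marginal_ge0. Qed.

(** Concavity along nonnegative directions: every hybrid lies above x, and partial derivatives
    decrease upwards. *)
Lemma multilinear_concave_upper f x y : submodular f -> in_cube x -> in_cube y ->
  le_vec x y ->
  multilinear f y <= multilinear f x + \sum_i (y i 0 - x i 0) * grad f x i.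
Proof.
move=> fs xc yc xy; rewrite -lerBlDl multilinear_telescope ler_sum// => i _.
rewrite ler_wpM2l ?subr_ge0//; apply: grad_antitone => //; first exact: hybrid_cube.
exact: le_hybrid.
Qed.

Lemma multilinear_concave_lower f x y : submodular f -> in_cube x -> in_cube y ->
  le_vec x y ->
  multilinear f x + \sum_i (y i 0 - x i 0) * grad f y i <= multilinear f y.
Proof.
move=> fs xc yc xy; rewrite -lerBrDl multilinear_telescope ler_sum// => i _.
rewrite ler_wpM2l ?subr_ge0//; apply: grad_antitone => //; first exact: hybrid_cube.
exact: hybrid_le.
Qed.

(** Pass through the coordinatewise maximum z: F(y) <= F(z) by monotonicity, and z - x <= y because
    both points are nonnegative. *)
Lemma multilinear_gap f x y : monotone f -> submodular f -> in_cube x -> in_cube y ->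
  multilinear f y <= multilinear f x + \sum_i y i 0 * grad f x i.
Proof.
move=> fm fs xc yc; have [/forallP xc' /forallP yc'] := (xc, yc).
pose z : 'cV[R]_n := \col_i Num.max (x i 0) (y i 0).
have zc : in_cube z.
  apply/forallP => i; rewrite !mxE; have := xc' i; have := yc' i.
  by rewrite /Num.max; case: ifP.
have xz : le_vec x z by move=> i; rewrite mxE le_max lexx.
have yz : le_vec y z by move=> i; rewrite mxE le_max lexx orbT.
apply: le_trans (multilinear_monotone fm yc zc yz) _.
apply: le_trans (multilinear_concave_upper fs xc zc xz) _.
rewrite lerD2l; apply: ler_sum => i _; rewrite ler_wpM2r ?grad_ge0// mxE.
have /andP[x0 _] := xc' i; have /andP[y0 _] := yc' i.
by rewrite /Num.max; case: ifP => _; lra.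
Qed.

(** By affinity in coordinate i the difference quotient is constant for h != 0. *)
Lemma gradientE f x i : gradient (multilinear f) x i 0 = grad f x i.
Proof.
rewrite mxE; apply: cvg_lim => //=.
apply: (@cvg_trans _ ((fun=> grad f x i) @ (0 : R)^')%classic); last exact: cvg_cst.
apply: near_eq_cvg; near=> h.
have -> : h *: delta_mx i 0 + x = update x i (h + x i 0).
  apply/matrixP => j k; rewrite ord1 !mxE eqxx andbT.
  by have [->|_] := eqVneq j i; rewrite /= ?mulr1// mulr0 add0r.
rewrite -[in X in _ = _ *: (_ - X)](update_id x i) multilinear_updateB addrK.
by rewrite /GRing.scale /= mulrA mulVf ?mul1r//; near: h; exact: nbhs_dnbhs_neq.
Unshelve. all: by end_near. Qed.

Lemma marginal_le_singleton i f S : submodular f -> normalized f ->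
  marginal i f S <= f [set i].
Proof.
move=> fs f0; apply: le_trans (marginal_antitone i fs (finset.sub0set S)) _.
by rewrite /marginal finset.setU0 finset.set0D f0 subr0.
Qed.

Lemma indicator_cube S : in_cube (indicator S).
Proof. by apply/forallP => i; rewrite mxE; case: (_ \in _); rewrite /= ?lexx ?ler01. Qed.

Lemma le_sum_singletons f S : submodular f -> normalized f -> monotone f ->
  f S <= \sum_i f [set i].
Proof.
move=> fs f0 fm.
rewrite -[f S]multilinear_indicator.
have le01 : le_vec (indicator finset.set0) (indicator finset.setT).
  by move=> i; rewrite !mxE !inE ler01.
have := multilinear_concave_upper fs (indicator_cube _) (indicator_cube _) le01.
rewrite !multilinear_indicator f0 add0r => H.
apply: le_trans (fm S finset.setT (finset.subsetT _)) _; apply: le_trans H _.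
apply: ler_sum => i _; rewrite !mxE !inE subr0 mul1r /grad multilinear_indicator.
exact: marginal_le_singleton.
Qed.

End MultilinearExtension.

(** * The packing relaxation *)

Lemma continuous_sum (R : realType) (T : topologicalType) (I : finType) (F : I -> T -> R) :
  (forall i, continuous (F i)) -> continuous (fun x => \sum_i F i x).
Proof.
move=> cF; apply: (@continuous_big R I +%R 0 xpredT); last by move=> i _; exact: cF.
exact: add_continuous.
Qed.

Section Relaxation.
Variables (R : realType) (m n : nat) (A : 'M[R]_(m, n)).
Implicit Types (x u v g : 'cV[R]_n).

(** The feasible polytope dilated by c: a run that has spent a fraction c of its time stays in this
    set, hence is feasible up to c = 1. *)
Definition scaled_feasible (c : R) x : Prop :=
  (forall i, (A *m x) i 0 <= c) /\ (forall j, 0 <= x j 0 <= c).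

Lemma scaled_feasible1 x : feasible A x <-> scaled_feasible 1 x.
Proof.
by split=> [[/forallP Ax /forallP xc]|[Ax xc]]; split=> //; exact/forallP.
Qed.

Lemma scaled_feasibleW (c c' : R) x : c <= c' -> scaled_feasible c x -> scaled_feasible c' x.
Proof.
move=> cc' [Ax xc]; split=> [i|j]; first exact: le_trans (Ax i) cc'.
by have /andP[-> xj] := xc j; exact: le_trans cc'.
Qed.

Lemma scaled_feasible_feasible (c : R) x : c <= 1 -> scaled_feasible c x -> feasible A x.
Proof. by move=> c1 xc; apply/scaled_feasible1; exact: scaled_feasibleW xc. Qed.

Lemma scaled_feasible0 : scaled_feasible 0 0.
Proof. by split=> [i|j]; rewrite ?mulmx0 mxE ?lexx. Qed.

Lemma scaled_feasibleD (c h : R) x u : 0 <= h -> scaled_feasible c x -> feasible A u ->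
  scaled_feasible (c + h) (x + h *: u).
Proof.
move=> h0 [Ax xc] /scaled_feasible1[Au uc]; split=> [i|j].
  rewrite mulmxDr -scalemxAr !mxE; have := Ax i; have := Au i.
  rewrite !mxE => Aui Axi; apply: lerD => //.
  by rewrite -[leRHS]mulr1 ler_wpM2l.
rewrite !mxE; have /andP[x0 x1] := xc j; have /andP[u0 u1] := uc j.
by rewrite addr_ge0 ?mulr_ge0//= lerD// -[leRHS]mulr1 ler_wpM2l.
Qed.

Lemma feasible_nneg v : feasible A v -> nneg v.
Proof. by move=> [_ /forallP vc] j; have /andP[] := vc j. Qed.

Lemma feasible_cube v : feasible A v -> in_cube v.
Proof. by case. Qed.

Lemma feasible0 : feasible A 0.
Proof. exact: scaled_feasible_feasible ler01 scaled_feasible0. Qed.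

Lemma feasible_convex u v (h : R) : feasible A u -> feasible A v -> 0 <= h <= 1 ->
  feasible A ((1 - h) *: u + h *: v).
Proof.
move=> fu fv /andP[h0 h1]; apply/scaled_feasible1; rewrite -(subrK h 1).
rewrite addrK; apply: scaled_feasibleD => //.
rewrite -[X in scaled_feasible X]add0r -[X in scaled_feasible _ X]add0r.
by apply: scaled_feasibleD => //; [rewrite subr_ge0|exact: scaled_feasible0].
Qed.

Lemma feasible_delta j : packing_matrix A -> feasible A (delta_mx j 0).
Proof.
move=> [_ Aj]; split; first exact: Aj.
by apply/forallP => k; rewrite mxE eqxx andbT; case: (_ == _); rewrite /= ?lexx ?ler01.
Qed.

Lemma power_maximizer_exists (p : R) g : 0 < p < 1 -> nneg g ->
  exists u, power_maximizer (feasible A) p g u.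
Proof.
move=> /andP[p0 p1] g0.
pose B : set 'rV[R]_n := [set w | forall j, 0 <= w ord0 j <= 1]%classic.
pose K : set 'rV[R]_n := [set w | forall i, \sum_j A i j * w ord0 j <= 1]%classic.
have KE (w : 'rV[R]_n) : (B `&` K)%classic w <-> feasible A w^T.
  split=> [[Bw Kw]|/scaled_feasible1[Aw wc]].
    apply/scaled_feasible1; split=> [i|j]; last first.
      by have := Bw j; rewrite mxE.
    rewrite mxE; apply: le_trans (Kw i); rewrite le_eqVlt; apply/orP; left.
    by apply/eqP/eq_bigr => j _; rewrite mxE.
  split=> [j|i]; first by have := wc j; rewrite mxE.
  by have := Aw i; rewrite mxE; under eq_bigr do rewrite mxE.
have cB : compact B.
  rewrite (_ : B = [set w | forall j, `[0, 1]%classic (w ord0 j)]%classic).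
    exact: (@rV_compact R n (fun=> `[0, 1]%classic) (fun=> @segment_compact R 0 1)).
  by apply/seteqP; split=> w H j; have := H j; rewrite /= in_itv.
have cK : closed K.
  have -> : K = (\bigcap_(i in [set: 'I_m])
      ((fun w : 'rV[R]_n => \sum_j A i j * w ord0 j) @^-1` [set x : R | x <= 1]))%classic.
    by apply/seteqP; split=> w H i; [move=> _; exact: H|exact: (H i I)].
  apply: closed_bigI => i _.
  apply: preimage_closed; last exact: closed_le.
  move=> w0 _; move: w0; apply: (@continuous_sum _ _ _ (fun j (w : 'rV[R]_n) => A i j * w ord0 j)) => j w.
  apply: (@continuousM R _ (fun=> A i j) (fun w : 'rV[R]_n => w ord0 j)).
    exact: cst_continuous.
  exact: coord_continuous.
have cBK : compact (B `&` K)%classic.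
  exact: compact_closedI.
have BK0 : ((B `&` K) !=set0)%classic.
  by exists 0; apply/KE; rewrite trmx0; exact: feasible0.
(* The absolute value makes the objective continuous on the whole space and disappears on feasible
   points. *)
have [|w wBK wmax] := @EVT_max_rV R n
  (fun w => \sum_j `|w ord0 j * g j 0| `^ p) _ BK0 cBK.
  apply: continuous_subspaceT.
  apply: (@continuous_sum _ _ _ (fun j (w : 'rV[R]_n) => `|w ord0 j * g j 0| `^ p)) => j w.
  apply: (@continuous_comp _ _ _ (fun w : 'rV[R]_n => w ord0 j * g j 0 : R) (fun x : R => `|x| `^ p) w).
    apply: (@continuousM R _ (fun w : 'rV[R]_n => w ord0 j) (fun=> g j 0)).
      exact: coord_continuous.
    exact: cst_continuous.
  by apply: continuous_powR_norm; rewrite p0 ltW.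
exists w^T; split; first by apply/KE; rewrite inE in wBK.
move=> v fv.
have vBK : v^T \in (B `&` K)%classic by rewrite inE; apply/KE; rewrite trmxK.
have := wmax _ vBK; rewrite /power_sum.
have w0 : nneg w^T by apply: feasible_nneg; apply/KE; rewrite inE in wBK.
have v0 := feasible_nneg fv.
congr (_ <= _); apply: eq_bigr => j _.
  by rewrite mxE ger0_norm ?mulr_ge0.
by have := w0 j; rewrite mxE => wj; rewrite ger0_norm ?mulr_ge0.
Qed.

Section Opt.
Variables (f : {set 'I_n} -> R).
Hypotheses (f0 : normalized f) (fm : monotone f) (fs : submodular f).

Lemma opt_ge x : feasible A x -> multilinear f x <= opt f A.
Proof.
move=> fx; apply: sup_ubound; last by exists x.
exists (f finset.setT) => _ [y fy <-].
rewrite -(multilinear_cst (f finset.setT) y).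
by apply: multilinear_le => [|S]; [exact: feasible_cube fy|apply: fm; exact: finset.subsetT].
Qed.

Lemma opt_le (c : R) : (forall x, feasible A x -> multilinear f x <= c) -> opt f A <= c.
Proof.
move=> H; apply: ge_sup; first by exists (multilinear f 0), 0 => //; exact: feasible0.
by move=> _ [x fx <-]; exact: H.
Qed.

Lemma multilinear0 : multilinear f 0 = 0.
Proof.
rewrite (_ : 0 = indicator R finset.set0) ?multilinear_indicator//.
by apply/matrixP => i j; rewrite !mxE inE.
Qed.

Lemma opt_ge0 : 0 <= opt f A.
Proof. by rewrite -multilinear0; exact/opt_ge/feasible0. Qed.

Lemma opt_ge_singleton j : packing_matrix A -> f [set j] <= opt f A.
Proof.
move=> pA; rewrite -[f _]multilinear_indicator; apply: opt_ge.
rewrite (_ : indicator R _ = delta_mx j 0); first exact: feasible_delta.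
by apply/matrixP => i k; rewrite !mxE ord1 inE eqxx andbT.
Qed.

(** With [opt_ge_singleton] this locates the optimum within a factor n of the largest singleton
    value, so O(log n) guesses suffice. *)
Lemma opt_le_sum (M : R) : (forall j, f [set j] <= M) -> opt f A <= n%:R * M.
Proof.
move=> fM; apply: opt_le => x fx; rewrite -(multilinear_cst (n%:R * M) x).
apply: multilinear_le => [|S]; first exact: feasible_cube fx.
apply: le_trans (le_sum_singletons S fs f0 fm) _.
apply: le_trans (ler_sum _ (fun j _ => fM j)) _.
by rewrite sumr_const card_ord mulr_natl.
Qed.

Lemma opt_gap x c : in_cube x ->
  (forall v, feasible A v -> \sum_j v j 0 * grad f x j <= c) ->
  opt f A <= multilinear f x + c.
Proof.
move=> xc H; apply: opt_le => y fy.
apply: le_trans (multilinear_gap fm fs xc (feasible_cube fy)) _.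
by rewrite lerD2l H.
Qed.

End Opt.
End Relaxation.

(** * One round of the algorithm *)

(** When no index below N satisfies [a], the search returns N itself; hence the condition in the
    last conclusion. *)
Lemma find_iota (a : pred nat) N (k := find a (iota 0 N)) :
  [/\ (k <= N)%N, (forall i, (i < k)%N -> ~~ a i) & ((k < N)%N -> a k)].
Proof.
have kN : (k <= N)%N by rewrite -[leqRHS](size_iota 0 N) find_size.
split=> // [i ik|kltN].
  by have := before_find 0%N ik; rewrite nth_iota ?(leq_trans ik)// add0n => ->.
have : has a (iota 0 N) by rewrite has_find size_iota.
by move/(nth_find 0%N); rewrite nth_iota// add0n.
Qed.

Section Steps.
Variables (R : realType) (m n : nat) (A : 'M[R]_(m, n)).

(** The default 0 is feasible, so the direction is feasible for all arguments, whatever the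
    estimates were. *)
Definition best_direction (p : R) (g : 'cV[R]_n) : 'cV[R]_n :=
  xget 0 [set u | power_maximizer (feasible A) p g u]%classic.

Lemma best_direction_feasible p g : feasible A (best_direction p g).
Proof.
by rewrite /best_direction; case: xgetP => [u -> []//|_]; exact: feasible0.
Qed.

Lemma best_directionP p g : 0 < p < 1 -> nneg g ->
  power_maximizer (feasible A) p g (best_direction p g).
Proof.
move=> p01 g0; have [u umax] := power_maximizer_exists A p01 g0.
exact: (@xgetPex _ 0 _ (ex_intro _ u umax)).
Qed.

(* [used] counts the portion of the unit of time that was spent, in units of
   [1 / D]; [slope] is the pointwise minimum of the past gradient estimates,
   so that it is antitone along a run even when the estimates are not. *)
Record state := State {
  point : 'cV[R]_n;
  slope : 'cV[R]_n;
  used : nat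
}.

Section Advance.
Variables (D : nat) (p tau : R) (s : state).

Definition probe (i : nat) : 'cV[R]_n :=
  point s + (i%:R / D%:R) *: best_direction p (slope s).

(** Clipping at 0 keeps the slope nonnegative, as power sums require, even when an estimate is
    negative. *)
Definition probe_slope (est : 'I_n -> R) : 'cV[R]_n :=
  \col_j Num.min (slope s j 0) (Num.max 0 (est j)).

(** If no probe before the end reaches the threshold, the result is [D - used s] and the move
    exhausts the unit of time exactly. *)
Definition stop (est : nat -> 'I_n -> R) : nat :=
  find (fun i => \sum_j best_direction p (slope s) j 0 * probe_slope (est i) j 0 <= tau)
    (iota 0 (D - used s)).

Definition advance (est : nat -> 'I_n -> R) : state :=
  State (probe (stop est)) (probe_slope (est (stop est))) (used s + stop est).

Definition valid : Prop :=
  (used s <= D)%N /\ scaled_feasible A ((used s)%:R / D%:R) (point s).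

Lemma stop_le est : valid -> (used s + stop est <= D)%N.
Proof.
move=> [sD _]; have [+ _ _] := find_iota (fun i =>
  \sum_j best_direction p (slope s) j 0 * probe_slope (est i) j 0 <= tau) (D - used s).
by rewrite -/(stop est) leq_subRL.
Qed.

Lemma probe_scaled i : valid ->
  scaled_feasible A ((used s + i)%:R / D%:R) (probe i).
Proof.
move=> [_ sv]; rewrite natrD mulrDl; apply: scaled_feasibleD => //.
exact: best_direction_feasible.
Qed.

Lemma probe_feasible i : (0 < D)%N -> valid -> (used s + i <= D)%N ->
  feasible A (probe i).
Proof.
move=> D0 sv siD; apply: scaled_feasible_feasible (probe_scaled i sv).
by rewrite ler_pdivrMr ?ltr0n// mul1r ler_nat.
Qed.

Lemma point_feasible : (0 < D)%N -> valid -> feasible A (point s).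
Proof.
move=> D0 [sD]; apply: scaled_feasible_feasible.
by rewrite ler_pdivrMr ?ltr0n// mul1r ler_nat.
Qed.

End Advance.

Lemma advance_valid D p tau s est : valid D s -> valid D (advance D p tau s est).
Proof. by move=> sv; split; [exact: stop_le|exact: probe_scaled]. Qed.

Lemma le_probe D p s i j : (i <= j)%N -> le_vec (probe D p s i) (probe D p s j).
Proof.
move=> ij k; rewrite !mxE lerD2l ler_wpM2r//.
  exact: feasible_nneg (best_direction_feasible _ _) k.
by rewrite ler_wpM2r ?invr_ge0// ler_nat.
Qed.

Lemma nneg_probe_slope s est : nneg (slope s) -> nneg (probe_slope s est).
Proof. by move=> s0 j; rewrite mxE le_min s0 le_max lexx. Qed.

(** * Accuracy, gain and optimality gap in one round *)

Section Progress.
Variables (f : {set 'I_n} -> R) (eta M : R) (D : nat).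
Hypotheses (pA : packing_matrix A) (n0 : (0 < n)%N) (D0 : (0 < D)%N).
Hypotheses (f0 : normalized f) (fm : monotone f) (fs : submodular f).
Hypotheses (M0 : 0 <= M) (Mopt : M <= opt f A).
Hypotheses (eta0 : 0 < eta) (eta1 : eta <= 20^-1).

Definition accurate (x : 'cV[R]_n) (est : 'I_n -> R) : Prop :=
  forall j, `|est j - grad f x j| <= eta * grad f x j + eta / n%:R * M.

(** One-sided, so that it survives taking the minimum with earlier slopes: the true gradient
    decreases along a run. *)
Definition upper_slope (x g : 'cV[R]_n) : Prop :=
  forall j, (1 - eta) * grad f x j <= g j 0 + eta / n%:R * M.

Lemma sum_slack (u : 'cV[R]_n) : in_cube u -> \sum_j u j 0 * (eta / n%:R * M) <= eta * M.
Proof.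
move=> /forallP uc; have nR : 0 < n%:R :> R by rewrite ltr0n.
apply: (@le_trans _ _ (\sum_(j < n) eta / n%:R * M)).
  apply: ler_sum => j _; have /andP[_ u1] := uc j.
  by rewrite -[leRHS]mul1r ler_wpM2r// !mulr_ge0 ?invr_ge0 ?ler0n ?(ltW eta0).
rewrite sumr_const card_ord -mulr_natl le_eqVlt; apply/orP; left; apply/eqP.
by field; exact: lt0r_neq0.
Qed.

Lemma advance_upper_slope p tau s est : valid D s -> nneg (slope s) ->
  upper_slope (point s) (slope s) ->
  (forall i, (used s + i <= D)%N -> accurate (probe D p s i) (est i)) ->
  upper_slope (point (advance D p tau s est)) (slope (advance D p tau s est)).
Proof.
have [e0 e1] := (eta0, eta1).
move=> sv s0 us acc j /=; set k := stop _ _ _ _ _.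
have skD : (used s + k <= D)%N by exact: stop_le.
have Pk := probe_feasible p D0 sv skD.
have := acc k skD j; rewrite ler_norml => /andP[lo _].
rewrite mxE; set e := Num.max _ _; rewrite /Num.min; case: ifP => _; last first.
  have : est k j <= e by rewrite le_max lexx orbT.
  lra.
apply: le_trans (us j); apply: ler_wpM2l; first lra.
apply: grad_antitone => //; [exact: feasible_cube (point_feasible D0 sv)|exact: feasible_cube Pk|].
move=> i; have := @le_probe D p s 0 k (leq0n k) i.
by rewrite {1}/probe mul0r scale0r addr0.
Qed.

(** At the grid point just before the stop the test failed, so the derivative along the direction is
    at least kappa there, and by concavity on the segment leading to it. The last grid step earns no
    credit, hence the -1. *)
Lemma advance_gain p tau s est (kappa := (tau - eta * M) / (1 + eta)) :
  valid D s -> 0 <= kappa ->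
  (forall i, (used s + i <= D)%N -> accurate (probe D p s i) (est i)) ->
  multilinear f (point s) + ((stop D p tau s est)%:R - 1) / D%:R * kappa <=
  multilinear f (point (advance D p tau s est)).
Proof.
have [e0 e1] := (eta0, eta1).
move=> sv k0 acc /=; set k := stop _ _ _ _ _.
have DR : 0 < D%:R :> R by rewrite ltr0n.
have skD : (used s + k <= D)%N by exact: stop_le.
have sc := feasible_cube (point_feasible D0 sv).
have Pk := feasible_cube (probe_feasible p D0 sv skD).
have probe0 : probe D p s 0 = point s by rewrite /probe mul0r scale0r addr0.
have [k00|kpos] := posnP k.
  by rewrite k00 probe0 sub0r mulN1r mulNr gerBl mulr_ge0 ?invr_ge0 ?ler0n.
have sk1D : (used s + k.-1 <= D)%N by apply: leq_trans skD; rewrite leq_add2l leq_pred.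
have Pk1 := feasible_cube (probe_feasible p D0 sv sk1D).
apply: le_trans (multilinear_monotone fm Pk1 Pk (le_probe _ _ _ (leq_pred k))).
have le1 := @le_probe D p s 0 k.-1 (leq0n _); rewrite probe0 in le1.
apply: le_trans (multilinear_concave_lower fs sc Pk1 le1).
rewrite lerD2l.
have -> : k%:R - 1 = k.-1%:R :> R by rewrite -{1}(prednK kpos) -natr1 addrK.
set u := best_direction p (slope s).
have -> : \sum_i (probe D p s k.-1 i 0 - point s i 0) * grad f (probe D p s k.-1) i =
    k.-1%:R / D%:R * \sum_i u i 0 * grad f (probe D p s k.-1) i.
  rewrite mulr_sumr; apply: eq_bigr => j _; rewrite [RHS]mulrA; congr (_ * _).
  by rewrite !mxE addrAC subrr add0r.
rewrite ler_wpM2l ?divr_ge0//.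
have uf := best_direction_feasible p (slope s); rewrite -/u in uf.
have u0 := feasible_nneg uf.
have k1k : (k.-1 < k)%N by rewrite prednK.
have [_ /(_ _ k1k) + _] := find_iota (fun i => \sum_j u j 0 * probe_slope s (est i) j 0 <= tau) (D - used s).
rewrite -ltNge => tlt.
rewrite /kappa ler_pdivrMr; last lra.
suff : \sum_j u j 0 * probe_slope s (est k.-1) j 0 <=
    (\sum_j u j 0 * grad f (probe D p s k.-1) j) * (1 + eta) + eta * M by lra.
apply: le_trans (lerD (lexx _) (sum_slack (feasible_cube uf))).
rewrite mulr_suml -big_split /=; apply: ler_sum => j _.
rewrite -mulrA -mulrDr ler_wpM2l// mxE ge_min; apply/orP; right.
have := acc _ sk1D j; rewrite ler_norml => /andP[_ hi].
have g0 := grad_ge0 j fm Pk1.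
rewrite ge_max; apply/andP; split; last lra.
by rewrite addr_ge0 ?mulr_ge0 ?invr_ge0 ?ler0n ?(ltW eta0)//; lra.
Qed.

(** The gain rate of [advance_gain] is at least the deficit W, which is the differential inequality
    of continuous greedy. The constant 13 absorbs the factor e^(8 eta), the slack in the gap and the
    estimation errors. *)
Lemma threshold_ge_gap tau s (W := (1 - 13 * eta) * opt f A - multilinear f (point s)) :
  valid D s ->
  (1 - eta) * (opt f A - multilinear f (point s)) <=
    expR (8 * eta) * tau + eta * opt f A ->
  0 < W ->
  W <= (tau - eta * M) / (1 + eta).
Proof.
have [e0 e1] := (eta0, eta1).
move=> sv H W0.
have F0 : 0 <= multilinear f (point s).
  rewrite -(multilinear0 f0); apply: multilinear_monotone => //.
  - exact: feasible_cube (feasible0 A).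
  - exact: feasible_cube (point_feasible D0 sv).
  - by move=> j; rewrite mxE; exact: feasible_nneg (point_feasible D0 sv) j.
have o0 := opt_ge0 A f0 fm.
have Fo := opt_ge fm (point_feasible D0 sv).
have Mo := Mopt; move: H W0 o0 Mo F0 Fo; rewrite /W.
set o := opt f A; set F := multilinear f (point s) => H W0 o0 Mo F0 Fo.
pose X := (1 - eta) * (o - F) - eta * o.
have etao : 0 <= eta * o by rewrite mulr_ge0// ltW.
have etaF : 0 <= eta * F by rewrite mulr_ge0// ltW.
have X0 : 0 <= X by rewrite /X; lra.
have tX : (1 - 8 * eta) * X <= tau.
  have E0 := expR_gt0 (8 * eta).
  have XE : X <= expR (8 * eta) * tau by rewrite /X; lra.
  have : (1 - 8 * eta) * X <= expR (- (8 * eta)) * X.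
    by rewrite ler_wpM2r//; have := expR_ge1Dx (- (8 * eta)); lra.
  move/le_trans; apply.
  by rewrite expRN mulrC ler_pdivrMr// mulrC.
rewrite ler_pdivlMr; last lra.
have eM : eta * M <= eta * o by rewrite ler_pM2l.
have e2o : 0 <= eta * (eta * o) by rewrite mulr_ge0// ltW.
have e2F : 0 <= eta * (eta * F) by rewrite mulr_ge0// ltW.
have e2oF : eta * (eta * F) <= eta * (eta * o).
  by rewrite !ler_pM2l.
move: tX; rewrite /X; lra.
Qed.

End Progress.
End Steps.

(** * The schedule and the invariant of a run *)

Section Schedule.
Variables (R : realType) (l q : nat).

(** The exponent is 1 - 2 / smoothing, a Frank-Wolfe step size. It is frozen at l q, where the
    potential 8 l / smoothing equals 8 / q. *)
Definition smoothing (t : nat) : nat := minn (t + 4) (l * q).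

Definition exponent (t : nat) : R := 1 - 2 / (smoothing t)%:R.

(** The truncated subtraction keeps the threshold at tau0 until [smoothing] reaches its cap. *)
Definition threshold (tau0 : R) (t : nat) : R :=
  tau0 * expR (- (8 / (l * q ^ 2)%:R) * (t + 4 - l * q)%:R).

(** The first summand covers the warm-up, the second suffices to divide the threshold by e^8. *)
Definition horizon : nat := l * q + l * q ^ 2.

(** Each round may waste one grid step; over the whole horizon this costs 1/q of the unit of
    time. *)
Definition resolution : nat := horizon * q.

Hypotheses (l0 : (0 < l)%N) (q20 : (20 <= q)%N).

Lemma smoothing_ge4 t : (4 <= smoothing t)%N.
Proof.
rewrite leq_min leq_addl /=; apply: leq_trans (leq_pmull _ l0).
exact: leq_trans q20.
Qed.

Lemma smoothing_real_ge4 t : 4 <= (smoothing t)%:R :> R.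
Proof. by rewrite ler_nat smoothing_ge4. Qed.

Lemma exponent_bounds t : 2^-1 <= exponent t < 1.
Proof.
have y4 := smoothing_real_ge4 t; have y0 : 0 < (smoothing t)%:R :> R by lra.
rewrite /exponent; have : 2 / (smoothing t)%:R <= 2^-1 :> R by rewrite ler_pdivrMr//; lra.
have : 0 < 2 / (smoothing t)%:R :> R by rewrite divr_gt0.
by move=> h1 h2; apply/andP; split; lra.
Qed.

Lemma smoothing_homo t : (smoothing t <= smoothing t.+1)%N.
Proof.
rewrite /smoothing leq_min geq_minr andbT.
by apply: leq_trans (geq_minl _ _) _; rewrite addSn.
Qed.

Lemma exponent_homo t : exponent t <= exponent t.+1.
Proof.
have y4 := smoothing_real_ge4 t; have y4' := smoothing_real_ge4 t.+1.
rewrite lerD2l lerN2 ler_pM2l// lef_pV2 ?posrE; [|lra|lra].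
by rewrite ler_nat smoothing_homo.
Qed.

Lemma threshold_gt0 tau0 t : 0 < tau0 -> 0 < threshold tau0 t.
Proof. by move=> h; rewrite mulr_gt0 ?expR_gt0. Qed.

Lemma threshold_early tau0 t : (t + 4 <= l * q)%N -> threshold tau0 t = tau0.
Proof. by rewrite /threshold -subn_eq0 => /eqP ->; rewrite mulr0 expR0 mulr1. Qed.

(** With p = 1 - 2/y the contraction brings the potential 8l/y down to 8l/y - 8l/y^2. Early on this
    is at most 8l/(y+1); later y = l q is fixed and the slack 8l/y^2 = 8/(l q^2) pays exactly for
    the decrease of the threshold. *)
Lemma schedule_step tau0 t (p := exponent t) (y := (smoothing t)%:R) : 0 < tau0 ->
  threshold tau0 t * expR (p * (8 * l%:R / y) + (1 - p) ^+ 2 / p * l%:R) <=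
  threshold tau0 t.+1 * expR (8 * l%:R / (smoothing t.+1)%:R).
Proof.
move=> tau00; have y4 : 4 <= y := smoothing_real_ge4 t.
have y0 : 0 < y by lra.
have [p2 p1] := andP (exponent_bounds t); rewrite -/p in p2 p1.
have lR : 0 < l%:R :> R by rewrite ltr0n.
have qR : 0 < q%:R :> R by rewrite ltr0n (leq_trans _ q20).
have step1 : p * (8 * l%:R / y) + (1 - p) ^+ 2 / p * l%:R <=
    8 * l%:R / y - 8 * l%:R / y ^+ 2.
  have -> : p * (8 * l%:R / y) = 8 * l%:R / y - 16 * l%:R / y ^+ 2.
    by rewrite /p /exponent -/y; field; lra.
  have -> : (1 - p) ^+ 2 = 4 / y ^+ 2 by rewrite /p /exponent -/y; field; lra.
  have h : 4 / y ^+ 2 * l%:R / p <= 4 / y ^+ 2 * l%:R * 2.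
    rewrite ler_pM2l; last by rewrite !mulr_gt0 ?invr_gt0 ?exprn_gt0.
    by rewrite -[leRHS]invrK lef_pV2 ?posrE//; lra.
  move: h; rewrite [4 / y ^+ 2 * l%:R / p]mulrAC.
  have -> : 4 / y ^+ 2 * l%:R * 2 = 8 * l%:R / y ^+ 2 by field; lra.
  have -> : 16 * l%:R / y ^+ 2 = 8 * l%:R / y ^+ 2 + 8 * l%:R / y ^+ 2 by field; lra.
  lra.
have [early|late] := ltnP (t + 4) (l * q).
  rewrite !threshold_early ?addSn//; last exact: ltnW.
  rewrite ler_pM2l// ler_expR; apply: le_trans step1 _.
  have yE : y = (t + 4)%:R by rewrite /y /smoothing (minn_idPl (ltnW early)).
  have -> : (smoothing t.+1)%:R = y + 1 :> R.
    by rewrite /smoothing addSn (minn_idPl early) yE natr1.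
  rewrite -subr_ge0.
  have -> : 8 * l%:R / (y + 1) - (8 * l%:R / y - 8 * l%:R / y ^+ 2) =
    8 * l%:R / (y ^+ 2 * (y + 1)) by field; lra.
  by rewrite divr_ge0 ?mulr_ge0 ?exprn_ge0//; lra.
have yE : y = l%:R * q%:R by rewrite /y /smoothing (minn_idPr late) natrM.
have -> : (smoothing t.+1)%:R = y.
  by rewrite /y /smoothing addSn (minn_idPr late) (minn_idPr (leqW late)).
have E : 8 / (l%:R * q%:R ^+ 2) = 8 * l%:R / y ^+ 2 :> R by rewrite yE; field; lra.
rewrite /threshold addSn subSn// -(@natr1 R (t + 4 - l * q)%N).
rewrite -[leLHS]mulrA -[leRHS]mulrA ler_pM2l// -!expRD ler_expR natrM natrX.
by rewrite E mulrDr mulr1; move: step1; lra.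
Qed.

Lemma exponent_initial : exponent 0 = 2^-1.
Proof.
rewrite /exponent /smoothing add0n (minn_idPl _); first by field.
by apply: leq_trans (leq_pmull _ l0); exact: leq_trans q20.
Qed.

Lemma threshold_final tau0 : 0 <= tau0 -> threshold tau0 horizon <= tau0 * expR (- 8).
Proof.
move=> tau00; rewrite ler_wpM2l// ler_expR mulNr lerN2.
have pos : 0 < (l * q ^ 2)%:R :> R.
  by rewrite ltr0n muln_gt0 l0 expn_gt0 (leq_trans _ q20).
rewrite -[leLHS](divfK (lt0r_neq0 pos)) ler_wpM2l ?divr_ge0 ?ler0n// ler_nat.
by rewrite /horizon -addnA addnC addnK leq_addr.
Qed.

Lemma horizon_gt0 : (0 < horizon)%N.
Proof. by rewrite addn_gt0 muln_gt0 l0 (leq_trans _ q20). Qed.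

Lemma resolution_gt0 : (0 < resolution)%N.
Proof. by rewrite muln_gt0 horizon_gt0 (leq_trans _ q20). Qed.

End Schedule.

(** * The invariant of a run and its consequences *)

Section Invariant.
Variables (R : realType) (m n : nat) (A : 'M[R]_(m, n)) (f : {set 'I_n} -> R).
Variables (l q : nat) (M tau0 : R).
Local Notation eta := (q%:R^-1 : R).
Local Notation D := (resolution l q).
Hypotheses (pA : packing_matrix A) (n0 : (0 < n)%N).
Hypotheses (l0 : (0 < l)%N) (q20 : (20 <= q)%N) (nl : n%:R <= expR l%:R :> R).
Hypotheses (f0 : normalized f) (fm : monotone f) (fs : submodular f).
Hypotheses (M0 : 0 <= M) (Mopt : M <= opt f A).
Hypotheses (tau0_gt0 : 0 < tau0) (opt_tau0 : opt f A <= tau0 <= 2 * opt f A).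

(** The fourth clause is the continuous greedy bound, where t/D accounts for one lost grid step per
    round. The last clause bounds the potential; it is waived once the time is spent, since the
    final move may end above the threshold. *)
Definition invariant (t : nat) (s : state R n) : Prop :=
  [/\ valid A D s, nneg (slope s), upper_slope f eta M (point s) (slope s),
      (1 - 13 * eta) * opt f A - multilinear f (point s) <=
        opt f A * expR ((t%:R - (used s)%:R) / D%:R)
    & used s = D \/
      forall v, feasible A v ->
        power_sum (exponent R l q t) (slope s) v <=
        (threshold l q tau0 t * expR (8 * l%:R / (smoothing l q t)%:R)) `^ exponent R l q t].

Lemma eta_gt0 : 0 < eta.
Proof. by rewrite invr_gt0 ltr0n (leq_trans _ q20). Qed.

Lemma eta_le : eta <= 20^-1.
Proof. by rewrite lef_pV2 ?posrE ?ltr0n ?ler_nat// (leq_trans _ q20). Qed.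

(** During the warm-up tau0 >= OPT suffices. Afterwards the potential factor is e^(8 eta); raising
    the exponent to 1 gives a linear bound over all feasible v, which [opt_gap] converts. *)
Lemma invariant_gap t s : invariant t s -> used s <> D ->
  (1 - eta) * (opt f A - multilinear f (point s)) <=
    expR (8 * eta) * threshold l q tau0 t + eta * opt f A.
Proof.
have [e0 e1] := (eta_gt0, eta_le).
move=> [sv s0 us _ [//|inv]] _.
have sf := point_feasible (resolution_gt0 l0 q20) sv.
have o0 := opt_ge0 A f0 fm.
have F0 : 0 <= multilinear f (point s).
  rewrite -(multilinear0 f0); apply: multilinear_monotone => //.
  - exact: feasible_cube (feasible0 A).
  - exact: feasible_cube sf.
  - by move=> j; rewrite mxE; exact: feasible_nneg sf j.
have etao : 0 <= eta * opt f A by rewrite mulr_ge0// ltW.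
have [early|late] := ltnP (t + 4) (l * q).
  rewrite threshold_early; last exact: ltnW.
  have ot : opt f A <= tau0 by case/andP: opt_tau0.
  have : tau0 <= expR (8 * eta) * tau0.
    rewrite ler_peMl ?(ltW tau0_gt0)// -[leLHS]expR0 ler_expR; lra.
  have : eta * multilinear f (point s) <= multilinear f (point s) by rewrite ler_piMl//; lra.
  lra.
have yE : 8 * l%:R / (smoothing l q t)%:R = 8 * eta.
  have lR : 0 < l%:R :> R by rewrite ltr0n.
  have qR : 0 < q%:R :> R by rewrite ltr0n (leq_trans _ q20).
  rewrite /smoothing (minn_idPr late) natrM; field; lra.
rewrite yE in inv.
have [p2 p1] := andP (exponent_bounds R l0 q20 t).
have t0 := threshold_gt0 l q t tau0_gt0.
have K0 : 0 < threshold l q tau0 t * expR (8 * eta) by rewrite mulr_gt0 ?expR_gt0.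
pose c := (threshold l q tau0 t * expR (8 * eta) + eta * M) / (1 - eta).
have pos : 0 < 1 - eta by lra.
have := @opt_gap _ _ _ A f fm fs (point s) c (feasible_cube sf).
have H v : feasible A v -> \sum_j v j 0 * grad f (point s) j <= c.
  move=> fv; rewrite /c ler_pdivlMr//.
  have v0 := feasible_nneg fv.
  have p01 : 0 < exponent R l q t <= 1 by apply/andP; split; lra.
  have := power_sum_monotone_exponent s0 v0 p01 K0 (inv v fv).
  rewrite (powRr1 (ltW K0)) => lin.
  apply: le_trans (lerD lin (sum_slack n0 M0 e0 (feasible_cube fv))).
  rewrite mulr_suml -big_split /=; apply: ler_sum => j _.
  rewrite powRr1; last by apply: mulr_ge0; [exact: v0|exact: s0].
  by rewrite -[leLHS]mulrA -mulrDr ler_wpM2l// mulrC; exact: us.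
move=> /(_ H) Hopt.
have : (1 - eta) * (opt f A - multilinear f (point s)) <= (1 - eta) * c.
  by rewrite ler_pM2l//; lra.
rewrite /c mulrC [(1 - eta) * (_ / _)]mulrC divfK ?lt0r_neq0//.
have : eta * M <= eta * opt f A by rewrite ler_pM2l.
lra.
Qed.

Lemma invariant_advance t s est : invariant t s ->
  (forall i, (used s + i <= D)%N ->
     accurate f eta M (probe A D (exponent R l q t) s i) (est i)) ->
  invariant t.+1 (advance A D (exponent R l q t) (threshold l q tau0 t) s est).
Proof.
have [e0 e1] := (eta_gt0, eta_le).
have D0 := resolution_gt0 l0 q20.
move=> inv acc; have [sv s0 us prog pot] := inv.
set p := exponent R l q t; set tau := threshold l q tau0 t.
set k := stop A D p tau s est.
have [p2 p1] := andP (exponent_bounds R l0 q20 t); rewrite -/p in p2 p1.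
have p01 : 0 < p < 1 by apply/andP; split; lra.
have DR : 0 < D%:R :> R by rewrite ltr0n.
have kD : (used s + k <= D)%N by exact: stop_le.
have av := @advance_valid _ _ _ A D p tau s est sv.
have used' : used (advance A D p tau s est) = (used s + k)%N by [].
split.
- exact: av.
- exact: nneg_probe_slope.
- exact: advance_upper_slope.
- have mono : multilinear f (point s) <= multilinear f (point (advance A D p tau s est)).
    apply: multilinear_monotone => //.
    + exact: feasible_cube (point_feasible D0 sv).
    + exact: feasible_cube (point_feasible D0 av).
    + by move=> j; have := @le_probe _ _ _ A D p s 0 k (leq0n _) j;
        rewrite {1}/probe mul0r scale0r addr0.
  set W := (1 - 13 * eta) * opt f A - multilinear f (point s) in prog.
  have o0 := opt_ge0 A f0 fm.
  have [W0|W0] := leP W 0.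
    apply: (@le_trans _ _ 0); first by move: W0; rewrite /W; lra.
    by rewrite mulr_ge0// expR_ge0.
  (* When no time is left, or when the stop is at k = 0, the used time is unchanged and the bound
     only weakens as t grows. *)
  have [uD|uD] := eqVneq (used s) D.
    have k0 : k = 0%N by move: kD; rewrite uD; case: (k) => // k'; rewrite addnS ltnNge leq_addr.
    rewrite used' k0 addn0; apply: (@le_trans _ _ W); first by rewrite /W lerB.
    apply: le_trans prog _; rewrite ler_wpM2l// ler_expR ler_pM2r ?invr_gt0//.
    by rewrite lerB// ler_nat.
  have kappa := threshold_ge_gap D0 f0 fm Mopt e0 e1 sv
    (invariant_gap inv (elimN eqP uD)) W0.
  have kap0 := le_trans (ltW W0) kappa.
  have gain := advance_gain n0 D0 fm fs M0 e0 e1 sv kap0 acc.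
  rewrite -/k -/W -/tau in gain kappa *.
  set a := (k%:R - 1) / D%:R in gain *.
  have [k0|k0] := posnP k.
    rewrite used' k0 addn0; apply: (@le_trans _ _ W); first by rewrite /W lerB.
    apply: le_trans prog _; rewrite ler_wpM2l// ler_expR ler_pM2r ?invr_gt0//.
    by rewrite lerB// ler_nat.
  have a0 : 0 <= a by rewrite divr_ge0// subr_ge0 ler1n.
  have : a * W <= a * ((tau - eta * M) / (1 + eta)) by rewrite ler_wpM2l.
  (* The deficit shrinks by 1 - a <= e^(-a) with a = (k-1)/D, which is exactly the change of the
     exponent in the invariant. *)
  move=> aW; apply: (@le_trans _ _ (W * (1 - a))).
    by move: gain aW; rewrite /W; lra.
  apply: (@le_trans _ _ (W * expR (- a))).
    by rewrite ler_pM2l//; exact: expR_ge1Dx.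
  apply: le_trans (ler_wpM2r (expR_ge0 _) prog) _.
  rewrite -mulrA -expRD ler_wpM2l// ler_expR used' /a natrD -natr1.
  rewrite le_eqVlt; apply/orP; left; apply/eqP; field; lra.
- have [uD|uD] := eqVneq (used s) D.
    left; apply/eqP; rewrite eqn_leq (stop_le _ _ _ sv) /= {1}uD leq_addr//.
  case: pot => [/eqP|pot]; first by rewrite (negbTE uD).
  (* If time remains, the stop test succeeded at k, so the contraction of the potential applies. *)
  have [knD|kltD] := eqVneq (used s + k)%N D; [by left|right].
  move=> v fv.
  have kk : (k < D - used s)%N by rewrite ltn_subRL ltn_neqAle kltD.
  have [_ _ /(_ kk) stopk] := find_iota (fun i => \sum_j best_direction A p (slope s) j 0 *
    probe_slope s (est i) j 0 <= tau) (D - used s).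
  have t0 := threshold_gt0 l q t tau0_gt0.
  have t0' := threshold_gt0 l q t.+1 tau0_gt0.
  have [umaxf _] := best_directionP A p01 s0.
  have s0' : nneg (probe_slope s (est k)) by exact: nneg_probe_slope.
  have gg j : probe_slope s (est k) j 0 <= slope s j 0 by rewrite mxE ge_min lexx.
  have dec := @power_maximizer_decrease R n (feasible A) (@feasible_nneg _ _ _ A)
    (@feasible_convex _ _ _ A) (fun j => feasible_delta j pA)
    p (slope s) (probe_slope s (est k)) (best_direction A p (slope s)) tau
    (8 * l%:R / (smoothing l q t)%:R) l%:R p01 s0 s0' gg t0 nl
    (best_directionP A p01 s0) (pot _ umaxf) stopk v fv.
  have v0 := feasible_nneg fv.
  apply: (@power_sum_monotone_exponent _ _ p).
  + exact: s0'.
  + exact: v0.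
  + by rewrite exponent_homo// andbT; case/andP: p01.
  + by rewrite mulr_gt0 ?expR_gt0.
  apply: le_trans dec _.
  apply: ge0_ler_powR; rewrite ?nnegrE.
  + by case/andP: p01 => /ltW.
  + by apply/ltW/mulr_gt0; rewrite ?expR_gt0.
  + by apply/ltW/mulr_gt0; rewrite ?expR_gt0.
  + exact: schedule_step.
Qed.

(** At exponent 1/2 and smoothing 4 the required bound is e^l tau0^(1/2); the n terms are at most
    tau0^(1/2) each, and n <= e^l. *)
Lemma invariant_initial est : accurate f eta M 0 est -> (forall j, est j <= tau0) ->
  invariant 0 (State 0 (\col_j Num.max 0 (est j)) 0).
Proof.
move=> acc est_tau0; split.
- by split; rewrite //= mul0r; exact: scaled_feasible0.
- by move=> j; rewrite mxE le_max lexx.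
- move=> j; rewrite mxE /=; have := acc j; rewrite ler_norml => /andP[lo _].
  have : est j <= Num.max 0 (est j) by rewrite le_max lexx orbT.
  lra.
- have [e0 e1] := (eta_gt0, eta_le).
  rewrite /= subrr mul0r expR0 mulr1 (multilinear0 f0) subr0.
  rewrite ler_piMl ?(opt_ge0 A f0 fm)//; lra.
right=> v fv; rewrite /= exponent_initial// threshold_early; last first.
  by apply: leq_trans (leq_pmull _ l0); rewrite add0n; exact: leq_trans q20.
rewrite (_ : smoothing l q 0 = 4%N); last first.
  rewrite /smoothing add0n; apply/minn_idPl.
  by apply: leq_trans (leq_pmull _ l0); exact: leq_trans q20.
have step j : (v j 0 * (\col_j Num.max 0 (est j)) j 0) `^ 2^-1 <= tau0 `^ 2^-1.
  have /scaled_feasible1[_ vc] := fv; have /andP[vj0 vj1] := vc j.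
  have m0 : 0 <= Num.max 0 (est j) by rewrite le_max lexx.
  rewrite mxE ge0_ler_powR ?nnegrE ?mulr_ge0 ?(ltW tau0_gt0)//.
  apply: (@le_trans _ _ (Num.max 0 (est j))); first by rewrite ler_piMl.
  by rewrite ge_max (ltW tau0_gt0) est_tau0.
apply: le_trans (ler_sum _ (fun j _ => step j)) _.
rewrite sumr_const card_ord -[leLHS]mulr_natl powRM ?expR_ge0 ?(ltW tau0_gt0)// [leLHS]mulrC.
rewrite ler_pM2l ?powR_gt0// -expRM; apply: le_trans nl _.
by rewrite ler_expR le_eqVlt; apply/orP; left; apply/eqP; field.
Qed.

(** If the time is spent, lost grid steps amount to at most eta, so the deficit is at most OPT
    e^(eta - 1). Otherwise the threshold is at most 2 e^(-8) OPT and the gap bound alone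
    suffices. *)
Lemma invariant_final s : invariant (horizon l q) s ->
  (1 - (expR 1)^-1 - 16 * eta) * opt f A <= multilinear f (point s).
Proof.
have [e0 e1] := (eta_gt0, eta_le).
have o0 := opt_ge0 A f0 fm.
have E1 : 0 < (expR 1)^-1 :> R by rewrite invr_gt0 expR_gt0.
have E1le : (expR 1)^-1 <= 2^-1 :> R.
  by rewrite lef_pV2 ?posrE ?expR_gt0//; have := expR_ge1Dx (1 : R); lra.
have eo0 : 0 <= eta * opt f A by rewrite mulr_ge0// ltW.
move=> inv; have [sv s0 us prog pot] := inv.
have [uD|uD] := eqVneq (used s) D.
  rewrite uD in prog.
  have qR : 0 < q%:R :> R by rewrite ltr0n (leq_trans _ q20).
  have TR : 0 < (horizon l q)%:R :> R by rewrite ltr0n horizon_gt0.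
  have := prog; have -> : ((horizon l q)%:R - D%:R) / D%:R = eta - 1 :> R.
    by rewrite /resolution natrM; field; lra.
  rewrite expRB => {}prog.
  have eta2 : expR eta <= 1 + 2 * eta.
    have := expR_ge1Dx (- eta); rewrite expRN => h.
    have h' : expR eta <= (1 - eta)^-1.
      by rewrite -[leLHS]invrK lef_pV2 ?posrE ?invr_gt0 ?expR_gt0//; lra.
    apply: le_trans h' _; rewrite invf_ple ?posrE; [|lra|lra].
    rewrite -div1r ler_pdivrMr; last lra.
    have : 0 <= eta * (1 - 2 * eta) by rewrite mulr_ge0//; lra.
    lra.
  have : opt f A * (expR eta / expR 1) <= opt f A * ((1 + 2 * eta) * (expR 1)^-1).
    by rewrite ler_wpM2l// ler_pM2r.
  have : eta * opt f A * (expR 1)^-1 <= eta * opt f A * 2^-1 by rewrite ler_wpM2l.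
  lra.
have gap := invariant_gap inv (elimN eqP uD).
have tfin := threshold_final l0 q20 (ltW tau0_gt0).
have ot : tau0 <= 2 * opt f A by case/andP: opt_tau0.
(* Since 8 eta <= 1, the left side is at most 2 e^(-7) OPT, and e^6 >= 7. *)
have E8 : expR (8 * eta) * threshold l q tau0 (horizon l q) <=
    opt f A * (2 / 7 * (expR 1)^-1).
  apply: (@le_trans _ _ (expR 1 * (2 * opt f A * expR (- 8)))).
    apply: ler_pM; rewrite ?expR_ge0 ?ler_expR//; try lra.
      by apply/ltW/threshold_gt0.
    by apply: le_trans tfin _; rewrite ler_wpM2r// expR_ge0.
  have -> : expR 1 * (2 * opt f A * expR (- 8)) = opt f A * (2 * expR (- 6) * expR (- 1)) :> R.
    have -> : expR (- 8) = expR (- 6) * expR (- 1) * expR (- 1) :> R.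
      by rewrite -!expRD; congr expR; ring.
    rewrite (expRN 1); field; exact: lt0r_neq0 (expR_gt0 _).
  rewrite -expRN ler_wpM2l// ler_pM2r ?expR_gt0//.
  have : expR (- 6) <= 7^-1 :> R.
    by rewrite expRN lef_pV2 ?posrE ?expR_gt0//; have := expR_ge1Dx (6 : R); lra.
  lra.
set e := (expR 1)^-1 in E1 E1le E8 *.
have pos : 0 < 1 - eta by lra.
suff : opt f A - multilinear f (point s) <= (e + 16 * eta) * opt f A by lra.
rewrite -(ler_pM2l pos); apply: le_trans gap _.
apply: le_trans (lerD E8 (lexx _)) _.
have -> : opt f A * (2 / 7 * e) + eta * opt f A = (2 / 7 * e + eta) * opt f A by ring.
rewrite mulrA ler_wpM2r//.
have : eta * e <= 20^-1 * e by rewrite ler_pM2r.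
have : eta * eta <= 20^-1 * eta by rewrite ler_pM2r.
lra.
Qed.

End Invariant.

(** * The algorithm with oracle access to F and its gradient *)

Section Robustness.
Variables (R : realType) (Query Answer Out : Type).
Implicit Types (ok : Query -> Answer -> Prop) (a : algorithm R Query Answer Out).

Fixpoint answers_ok ok (qs : seq Query) (ans : seq Answer) : Prop :=
  match qs, ans with
  | [::], [::] => True
  | q :: qs', b :: ans' => ok q b /\ answers_ok ok qs' ans'
  | _, _ => False
  end.

(** Quantifying over all admissible answers lets one correctness proof serve both exact answers and
    sampled estimates. *)
Fixpoint robust ok (E : set Out) a : Prop :=
  match a with
  | Output x => E x
  | Round qs k => forall ans, answers_ok ok qs ans -> robust ok E (k ans)
  | Flip _ _ => False
  end.

(* The answers are arbitrary here: when they are estimated by sampling, the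
   costs must be bounded even if some of the estimates fail. *)
Fixpoint bounded (r Q : nat) a {struct a} : Prop :=
  match a with
  | Output _ => True
  | Round qs k =>
      match r with
      | 0%N => False
      | r'.+1 => (size qs <= Q)%N /\ forall ans, bounded r' (Q - size qs) (k ans)
      end
  | Flip _ _ => False
  end.

Lemma bounded_deterministic r Q a : bounded r Q a -> deterministic a.
Proof.
elim: a r Q => [x|qs k IH|p k IH] r Q //=.
by case: r => // r [_ H] ans; exact: IH (H ans).
Qed.

Lemma bounded_rounds (oracle : Query -> Answer) r Q a :
  bounded r Q a -> (rounds oracle a <= r)%N.
Proof.
elim: a r Q => [x|qs k IH|p k IH] r Q //=.
by case: r => // r [_ H]; rewrite ltnS; exact: IH (H _).
Qed.

Lemma bounded_queries (oracle : Query -> Answer) r Q a :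
  bounded r Q a -> (queries oracle a <= Q)%N.
Proof.
elim: a r Q => [x|qs k IH|p k IH] r Q //=.
by case: r => // r [sQ H]; rewrite -leq_subRL//; exact: IH (H _).
Qed.

Lemma answers_ok_map ok (oracle : Query -> Answer) qs :
  (forall q, ok q (oracle q)) -> answers_ok ok qs (map oracle qs).
Proof. by move=> H; elim: qs => //= q qs IH; split. Qed.

Lemma robust_exact ok (oracle : Query -> Answer) (E : set Out) a :
  (forall q, ok q (oracle q)) -> robust ok E a -> pr_output oracle E a = 1.
Proof.
move=> H; elim: a => [x Ex|qs k IH|p k IH] //=; first by rewrite indicE mem_set.
by move=> rob; apply: IH; apply: rob; exact: answers_ok_map.
Qed.

End Robustness.

Section Ask.
Variables (R : realType) (Query Out : Type) (I : finType) (q : I -> Query).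

Definition ask (k : (I -> R) -> algorithm R Query R Out) : algorithm R Query R Out :=
  Round (map q (enum I)) (fun ans => k (fun i => nth 0 ans (index i (enum I)))).

Lemma answers_ok_nth (ok : Query -> R -> Prop) (s : seq I) ans i :
  answers_ok ok (map q s) ans -> i \in s -> ok (q i) (nth 0 ans (index i s)).
Proof.
elim: s ans => [|j s IH] [|b ans] //= [okj oks].
rewrite inE eq_sym; have [<-//|_] /= := eqVneq j i.
exact: IH.
Qed.

Lemma robust_ask ok E k :
  (forall e, (forall i, ok (q i) (e i)) -> robust ok E (k e)) -> robust ok E (ask k).
Proof.
move=> H ans okans; apply: H => i.
by apply: answers_ok_nth => //; rewrite mem_enum.
Qed.

Lemma bounded_ask r Q k :
  (forall e, bounded r Q (k e)) -> bounded r.+1 (#|I| + Q) (ask k).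
Proof.
by move=> H; split; rewrite size_map -cardE ?leq_addr// => ans; rewrite addKn.
Qed.

End Ask.

(** * The parallel greedy algorithm and its correctness *)

Section Algorithm.
Variables (R : realType) (n m : nat) (A : 'M[R]_(m, n)) (l q : nat).
Local Notation D := (resolution l q).
Local Notation alg := (algorithm R (multilinear_query R n) R 'cV[R]_n).

Lemma cube0 : in_cube (0 : 'cV[R]_n).
Proof. by apply/forallP => i; rewrite mxE lexx ler01. Qed.

(** Probes past the end of the unit of time may leave the cube. They are redirected to 0, and
    [advance] does not read their answers from a valid state. *)
Definition cube_at (x : 'cV[R]_n) : cube_point R n :=
  insubd (exist (fun x => in_cube x) 0 cube0) x.

Lemma cube_atK x : in_cube x -> \val (cube_at x) = x.
Proof. exact: insubdK. Qed.

(** One round serves all guesses, grid points and coordinates at once; the last round compares the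
    end points by value. *)
Fixpoint loop (guess : 'I_l.+2 -> R) (r t : nat) (st : 'I_l.+2 -> state R n) : alg :=
  match r with
  | 0%N =>
      ask (fun k => QueryValue (cube_at (point (st k))))
        (fun e => Output _ _ _ (point (st [arg max_(k > ord0) e k]%O)))
  | r'.+1 =>
      ask (fun kij : 'I_l.+2 * 'I_D.+1 * 'I_n =>
             QueryPartial (cube_at (probe A D (exponent R l q t) (st kij.1.1) kij.1.2)) kij.2)
        (fun e => loop guess r' t.+1 (fun k =>
           advance A D (exponent R l q t) (threshold l q (guess k) t) (st k)
             (fun i j => e (k, inord i, j))))
  end.

(** Partial derivatives at 0 are singleton values, so their maximum starts a geometric list of
    guesses for the optimum. *)
Definition greedy : alg :=
  ask (fun j => QueryPartial (cube_at 0) j)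
    (fun e => loop (fun k => 2 ^+ k * \big[Num.max/0]_j e j) (horizon l q) 0
       (fun=> State 0 (\col_j Num.max 0 (e j)) 0)).

Definition greedy_queries : nat :=
  n + (horizon l q * (l.+2 * D.+1 * n) + l.+2).

Lemma loop_bounded guess r t st :
  bounded r.+1 (r * (l.+2 * D.+1 * n) + l.+2) (loop guess r t st).
Proof.
elim: r t st => [|r IH] t st.
  rewrite (_ : _ + _ = #|'I_l.+2| + 0)%N; last by rewrite card_ord addn0.
  exact: bounded_ask.
rewrite (_ : _ + _ = #|{: 'I_l.+2 * 'I_D.+1 * 'I_n}| + (r * (l.+2 * D.+1 * n) + l.+2))%N.
  by apply: bounded_ask => e; exact: IH.
by rewrite !card_prod !card_ord mulSn addnA.
Qed.

Lemma greedy_bounded : bounded (horizon l q).+2 greedy_queries greedy.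
Proof.
have -> : greedy_queries = (#|'I_n| + (horizon l q * (l.+2 * D.+1 * n) + l.+2))%N.
  by rewrite card_ord.
by apply: bounded_ask => e; exact: loop_bounded.
Qed.

Section Correctness.
Variables (f : {set 'I_n} -> R).
Local Notation eta := (q%:R^-1 : R).
Hypotheses (pA : packing_matrix A) (n0 : (0 < n)%N).
Hypotheses (l0 : (0 < l)%N) (q20 : (20 <= q)%N) (nl : (n <= 2 ^ l)%N).
Hypotheses (fge0 : forall S, 0 <= f S).
Hypotheses (f0 : normalized f) (fm : monotone f) (fs : submodular f).

Definition max_singleton : R := \big[Num.max/0]_j f [set j].
Local Notation M := max_singleton.

(** An upper bound on the random variable whose mean is queried. It makes the additive error eta M
    for values and eta M / n for partial derivatives. *)
Definition query_range (qu : multilinear_query R n) : R :=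
  match qu with QueryValue _ => n%:R * M | QueryPartial _ _ => M end.

Definition acceptable (qu : multilinear_query R n) (b : R) : Prop :=
  `|b - multilinear_oracle f qu| <=
    eta * multilinear_oracle f qu + eta / n%:R * query_range qu.

Definition good : set 'cV[R]_n :=
  [set x | feasible A x /\ (1 - (expR 1)^-1 - 20 * eta) * opt f A <= multilinear f x]%classic.

Lemma max_singleton_ge0 : 0 <= M.
Proof. exact: bigmax_ge_id. Qed.

Lemma singleton_le_max j : f [set j] <= M.
Proof. exact: le_bigmax. Qed.

Lemma max_singleton_le_opt : M <= opt f A.
Proof.
apply/bigmax_leP; split=> [|j _]; first exact: opt_ge0.
exact: opt_ge_singleton.
Qed.

Lemma acceptable_partial x est : in_cube x ->
  (forall j, acceptable (QueryPartial (cube_at x) j) (est j)) -> accurate f eta M x est.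
Proof.
move=> xc H j; have := H j; rewrite /acceptable /= cube_atK//.
by rewrite -!(gradientE f x j).
Qed.

(** Both the selected and the successful run have value estimates within 2 eta OPT, so the selection
    costs 4 eta OPT, which turns 16 into the 20 of [good]. *)
Lemma best_value (est : 'I_l.+2 -> R) (st : 'I_l.+2 -> state R n) k :
  (forall k, feasible A (point (st k))) ->
  (forall k, acceptable (QueryValue (cube_at (point (st k)))) (est k)) ->
  (1 - (expR 1)^-1 - 16 * eta) * opt f A <= multilinear f (point (st k)) ->
  good (point (st [arg max_(k > ord0) est k]%O)).
Proof.
have [e0 e1] := (eta_gt0 R q20, eta_le R q20).
move=> sf acc Fk; split=> //.
case: arg_maxP => //= c _ cmax.
have value k' : `|est k' - multilinear f (point (st k'))| <=
    eta * multilinear f (point (st k')) + eta * M.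
  have := acc k'; rewrite /acceptable /= cube_atK; last exact: feasible_cube (sf k').
  by rewrite mulrA divfK// pnatr_eq0 -lt0n.
have /andP[_ hi] : _ && _ := etrans (esym (ler_norml _ _)) (value c).
have /andP[lo _] : _ && _ := etrans (esym (ler_norml _ _)) (value k).
have ck := cmax k isT.
have Fc1 : eta * multilinear f (point (st c)) <= eta * opt f A.
  by rewrite ler_pM2l//; exact: opt_ge.
have Fk1 : eta * multilinear f (point (st k)) <= eta * opt f A.
  by rewrite ler_pM2l//; exact: opt_ge.
have eM : eta * M <= eta * opt f A by rewrite ler_pM2l//; exact: max_singleton_le_opt.
lra.
Qed.

Lemma expR_ge_nat : n%:R <= expR l%:R :> R.
Proof.
apply: (@le_trans _ _ (2 ^+ l)); first by rewrite -natrX ler_nat.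
rewrite -[l%:R]mulr1 expRM_natl.
by apply: lerXn2r; rewrite ?nnegrE ?expR_ge0//; have := expR_ge1Dx (1 : R); lra.
Qed.

Lemma loop_robust guess r t st : (r + t = horizon l q)%N ->
  (forall k, valid A D (st k)) ->
  opt f A <= 0 \/ (exists k, [/\ 0 < guess k, opt f A <= guess k <= 2 * opt f A
    & invariant A f l q M (guess k) t (st k)]) ->
  robust acceptable good (loop guess r t st).
Proof.
have D0 := resolution_gt0 l0 q20.
have M0 := max_singleton_ge0.
have Mo := max_singleton_le_opt.
elim: r t st => [|r IH] t st rt sv cases; apply: robust_ask => e acc.
  have sf k : feasible A (point (st k)) by exact: point_feasible D0 (sv k).
  case: cases => [opt0|[k [g0 go inv]]]; last first.
    apply: (@best_value _ _ k) => //; apply: (invariant_final n0 l0 q20 f0 fm fs M0 Mo g0 go).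
    by rewrite -rt add0n.
  split=> //=; apply: (@le_trans _ _ 0).
    have -> : opt f A = 0 by apply/eqP; rewrite eq_le opt0 opt_ge0.
    by rewrite mulr0.
  by apply: multilinear_ge0; first exact: feasible_cube (sf _).
apply: IH; first by rewrite addnS -addSn.
  by move=> k; exact: advance_valid.
case: cases => [opt0|[k [g0 go inv]]]; [by left|right].
exists k; split; [exact: g0|exact: go|].
apply: (invariant_advance pA n0 l0 q20 expR_ge_nat f0 fm fs M0 Mo g0 go inv).
move=> i siD.
apply: acceptable_partial.
  exact: feasible_cube (probe_feasible _ D0 (sv k) siD).
move=> j; have := acc (k, inord i, j).
by rewrite /= inordK// ltnS (leq_trans _ siD)// leq_addl.
Qed.

Lemma greedy_robust : robust acceptable good greedy.
Proof.
have [e0 e1] := (eta_gt0 R q20, eta_le R q20).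
have M0 := max_singleton_ge0.
have nR : 1 <= n%:R :> R by rewrite ler1n.
apply: robust_ask => e acc; apply: loop_robust; first by rewrite addn0.
  by move=> k; split; rewrite //= mul0r; exact: scaled_feasible0.
have eacc : accurate f eta M 0 e by apply: acceptable_partial => //; exact: cube0.
have grad0 j : grad f 0 j = f [set j].
  rewrite /grad (_ : 0 = indicator R finset.set0); last first.
    by apply/matrixP => i k; rewrite !mxE inE.
  by rewrite multilinear_indicator /marginal finset.setU0 finset.set0D f0 subr0.
have etan : eta / n%:R * M <= eta * M.
  rewrite ler_wpM2r// ler_pdivrMr; last lra.
  by rewrite ler_peMr// ltW.
have bound j : (1 - eta) * f [set j] - eta * M <= e j <= (1 + eta) * f [set j] + eta * M.
  have := eacc j; rewrite grad0 ler_norml => /andP[lo hi].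
  by apply/andP; split; lra.
(* The estimated maximum agrees with M up to a factor 2 in both directions. *)
set Mt := \big[Num.max/0]_j e j.
have eM : eta * M <= 20^-1 * M by rewrite ler_wpM2r.
have Mt_le : Mt <= 2 * M.
  apply/bigmax_leP; split=> [|j _]; first lra.
  have /andP[_ hi] := bound j; apply: le_trans hi _.
  have : (1 + eta) * f [set j] <= (1 + eta) * M.
    by rewrite ler_pM2l ?singleton_le_max//; lra.
  lra.
have Mt_ge : M <= 2 * Mt.
  have Mt0 : 0 <= Mt by exact: bigmax_ge_id.
  have pos : 0 < 1 - eta by lra.
  have : M <= (Mt + eta * M) / (1 - eta).
    apply/bigmax_leP; split=> [|j _]; rewrite ler_pdivlMr ?mul0r//.
      by rewrite addr_ge0 ?mulr_ge0 ?(ltW e0).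
    have /andP[lo _] := bound j.
    have : e j <= Mt by exact: le_bigmax.
    lra.
  rewrite ler_pdivlMr//; lra.
have [opt0|opt0] := leP (opt f A) 0; first by left.
right.
have Mpos : 0 < M.
  rewrite lt_neqAle M0 andbT; apply: contraTneq opt0 => ME; rewrite -leNgt.
  by have := opt_le_sum A f0 fm fs singleton_le_max; rewrite -ME mulr0.
have Mtpos : 0 < Mt by lra.
have big_guess : opt f A <= 2 ^+ l.+1 * Mt.
  apply: le_trans (opt_le_sum A f0 fm fs singleton_le_max) _.
  rewrite exprSr -mulrA; by apply: ler_pM => //; rewrite -natrX ler_nat.
have exk : exists k, opt f A <= 2 ^+ k * Mt by exists l.+1.
(* The least such k overshoots the optimum by at most a factor 2, and k <= l + 1 because OPT <= n M
   <= 2^(l+1) Mt. *)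
have [k kP kmin] := ex_minnP exk.
have kl : (k < l.+2)%N by rewrite ltnS; exact: kmin.
have Mo := max_singleton_le_opt.
have k2 : 2 ^+ k * Mt <= 2 * opt f A.
  case: k {kl} kP kmin => [|k] kP kmin; first by rewrite expr0 mul1r; lra.
  rewrite exprS -mulrA ler_pM2l// ltW// ltNge; apply/negP => /kmin.
  by rewrite ltnn.
have g0 : 0 < 2 ^+ k * Mt by rewrite mulr_gt0// exprn_gt0.
exists (Ordinal kl); split=> //=; first by rewrite kP.
apply: invariant_initial => //.
- exact: expR_ge_nat.
- move=> j; apply: (@le_trans _ _ Mt); first exact: le_bigmax.
  by rewrite ler_peMl ?(ltW Mtpos)// exprn_ege1// ler1n.
Qed.

End Correctness.
End Algorithm.

(** * Concentration of sample means *)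

(** Inverting 1 - w <= e^(-w) gives e^w <= 1/(1-w), which lies below the quadratic on this range. *)
Lemma expR_le_quadratic (R : realType) (w : R) :
  - 2^-1 <= w <= 2^-1 -> expR w <= 1 + w + 2 * w ^+ 2.
Proof.
move=> /andP[w0 w1]; have h := expR_ge1Dx (- w); rewrite expRN in h.
have pos : 0 < 1 - w by lra.
have : expR w <= (1 - w)^-1.
  by rewrite -[leLHS]invrK lef_pV2 ?posrE ?invr_gt0 ?expR_gt0//; lra.
move=> /le_trans; apply; rewrite -div1r ler_pdivrMr// -subr_ge0.
have -> : (1 + w + 2 * w ^+ 2) * (1 - w) - 1 = w ^+ 2 * (1 - 2 * w) by ring.
by rewrite mulr_ge0 ?sqr_ge0//; lra.
Qed.

Section SampleMean.
Variables (R : realType) (n : nat) (x : 'cV[R]_n).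
Hypothesis xc : in_cube x.
Implicit Types (phi psi : seq {set 'I_n} -> R).

(* Expectation over T independent random sets with marginals x. *)
Fixpoint mean (T : nat) phi : R :=
  match T with
  | 0%N => phi [::]
  | T'.+1 => multilinear (fun S => mean T' (fun s => phi (S :: s))) x
  end.

Lemma mean_le T phi psi : (forall s, phi s <= psi s) -> mean T phi <= mean T psi.
Proof.
elim: T phi psi => //= T IH phi psi H.
by apply: multilinear_le => // S; apply: IH => s; exact: H.
Qed.

Lemma mean_cst T (c : R) : mean T (fun=> c) = c.
Proof. by elim: T => //= T ->; rewrite multilinear_cst. Qed.

Lemma mean_cstB T (c : R) phi : mean T (fun s => c - phi s) = c - mean T phi.
Proof.
elim: T phi => //= T IH phi.
under eq_fun do rewrite IH.
by rewrite multilinearB multilinear_cst.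
Qed.

Lemma meanD T phi psi : mean T (fun s => phi s + psi s) = mean T phi + mean T psi.
Proof.
elim: T phi psi => //= T IH phi psi.
under eq_fun do rewrite IH.
by rewrite !multilinearE -big_split; apply: eq_bigr => S _; rewrite mulrDl.
Qed.

(** Independence of the samples; the factor c lets the induction absorb the first sample. *)
Lemma mean_prod T (c : R) (g : {set 'I_n} -> R) :
  mean T (fun s => c * \prod_(S <- s) g S) = c * multilinear g x ^+ T.
Proof.
elim: T c => [|T IH] c /=; first by rewrite big_nil.
under eq_fun => S.
  under [X in mean T X]eq_fun => s do rewrite big_cons mulrA.
  rewrite IH [c * _]mulrC -mulrA.
over.
rewrite exprS mulrCA; under eq_fun do rewrite mulrC.
by rewrite multilinearZ mulrC.
Qed.

Section Concentration.
Variables (h : {set 'I_n} -> R) (B eta a : R) (T : nat).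
Hypotheses (h0 : forall S, 0 <= h S) (hB : forall S, h S <= B).
Hypotheses (eta01 : 0 < eta <= 1) (T0 : (0 < T)%N).

(** For z in [0,1], e^(wz) <= 1 + (w + 2 w^2) z because z^2 <= z; then take expectations. *)
Lemma exp_moment (w : R) : 0 < B -> - 2^-1 <= w <= 2^-1 ->
  multilinear (fun S => expR (w * (h S / B))) x <=
  expR ((w + 2 * w ^+ 2) * (multilinear h x / B)).
Proof.
move=> B0 w12; apply: le_trans (expR_ge1Dx _).
have -> : 1 + (w + 2 * w ^+ 2) * (multilinear h x / B) =
  multilinear (fun S => 1 + (w + 2 * w ^+ 2) * (h S / B)) x.
  have -> : (w + 2 * w ^+ 2) * (multilinear h x / B) =
    multilinear (fun S => (w + 2 * w ^+ 2) / B * h S) x by rewrite multilinearZ; ring.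
  rewrite -[X in X + _ = _](multilinear_cst 1 x) !multilinearE -big_split /=.
  by apply: eq_bigr => S _; ring.
apply: multilinear_le => // S.
have z0 : 0 <= h S / B by rewrite divr_ge0 ?h0// ltW.
have z1 : h S / B <= 1 by rewrite ler_pdivrMr// mul1r hB.
set z := h S / B in z0 z1 *.
have [w0 w1] := andP w12.
have wz : - 2^-1 <= w * z <= 2^-1.
  have : `|w * z| <= 2^-1.
    rewrite normrM (ger0_norm z0); apply: (@le_trans _ _ `|w|); last by rewrite ler_norml w0.
    by rewrite ler_piMr.
  by rewrite ler_norml.
apply: le_trans (expR_le_quadratic wz) _.
have : w ^+ 2 * (z * z) <= w ^+ 2 * z by rewrite ler_wpM2l ?sqr_ge0// ler_piMr.
lra.
Qed.

Lemma chernoff (mu := multilinear h x) :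
  mean T (fun s => (~~ (`|(\sum_(S <- s) h S) / T%:R - mu| <= eta * mu + a * B))%:R)
  <= 2 * expR (- (T%:R * (eta / 2) * a)).
Proof.
have [e0 e1] := andP eta01.
have TR : 0 < T%:R :> R by rewrite ltr0n.
have mu0 : 0 <= mu by exact: multilinear_ge0.
have B0 : 0 <= B := le_trans (h0 finset.set0) (hB finset.set0).
have [BE|Bn0] := eqVneq B 0.
  have hE S : h S = 0 by apply/eqP; rewrite eq_le h0 andbT -BE hB.
  have muE : mu = 0 by rewrite /mu multilinearE big1// => S _; rewrite hE mul0r.
  apply: (@le_trans _ _ (mean T (fun=> 0))).
    apply: mean_le => s; rewrite big1 => [|S _]; last exact: hE.
    by rewrite muE BE !mul0r subrr normr0 !mulr0 addr0 lexx.
  by rewrite mean_cst mulr_ge0// expR_ge0.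
have {Bn0}Bpos : 0 < B by rewrite lt_neqAle eq_sym Bn0.
(* With this choice 2 w^2 = eta w, so in both tails the multiplicative error cancels the
   second-order term and leaves T w a. *)
pose w := eta / 2.
pose cp := expR (- (w * T%:R * ((1 + eta) * (mu / B) + a))).
pose cm := expR (w * T%:R * ((1 - eta) * (mu / B) - a)).
pose gp S := expR (w * (h S / B)).
pose gm S := expR (- w * (h S / B)).
have prodE v s : \prod_(S <- s) expR (v * (h S / B)) = expR (v / B * \sum_(S <- s) h S).
  by rewrite -expR_sum mulr_sumr; congr expR; apply: eq_bigr => S _; ring.
(* Exponential Markov inequality: on a failure one of the two exponents is nonnegative, so its
   summand is at least 1. *)
apply: (@le_trans _ _ (mean T (fun s => cp * \prod_(S <- s) gp S + cm * \prod_(S <- s) gm S))).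
  apply: mean_le => s; rewrite /gp /gm !prodE /cp /cm -!expRD.
  pose Sg : R := \sum_(S <- s) h S; rewrite -/Sg.
  case: (boolP (`|Sg / T%:R - mu| <= eta * mu + a * B)) => [_|] /=.
    by rewrite addr_ge0 ?expR_ge0.
  rewrite ler_norml negb_and -!ltNge => /orP[lo|hi].
    rewrite ler_wpDl ?expR_ge0// -[leLHS]expR0 ler_expR.
    have : Sg <= T%:R * (mu - eta * mu - a * B).
      by rewrite mulrC -ler_pdivrMr//; lra.
    move=> HS.
    have -> : w * T%:R * ((1 - eta) * (mu / B) - a) + - w / B * Sg =
      w / B * (T%:R * (mu - eta * mu - a * B) - Sg) by field; lra.
    by rewrite mulr_ge0 ?divr_ge0 ?subr_ge0// /w; lra.
  rewrite ler_wpDr ?expR_ge0// -[leLHS]expR0 ler_expR.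
  have : T%:R * (mu + eta * mu + a * B) <= Sg.
    by rewrite mulrC -ler_pdivlMr//; lra.
  move=> HS.
  have -> : - (w * T%:R * ((1 + eta) * (mu / B) + a)) + w / B * Sg =
    w / B * (Sg - T%:R * (mu + eta * mu + a * B)) by field; lra.
  by rewrite mulr_ge0 ?divr_ge0 ?subr_ge0// /w; lra.
rewrite meanD !mean_prod.
have bnd v : - 2^-1 <= v <= 2^-1 ->
    multilinear (fun S => expR (v * (h S / B))) x ^+ T <=
    expR (T%:R * ((v + 2 * v ^+ 2) * (mu / B))).
  move=> v12; rewrite expRM_natl; apply: lerXn2r; rewrite ?nnegrE ?expR_ge0//.
    by apply: multilinear_ge0 => // S; exact: expR_ge0.
  exact: exp_moment.
have hp : multilinear gp x ^+ T <= _ := @bnd w ltac:(rewrite /w; apply/andP; split; lra).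
have hm : multilinear gm x ^+ T <= _ := @bnd (- w) ltac:(rewrite /w; apply/andP; split; lra).
have two : 2 * expR (- (T%:R * (eta / 2) * a)) =
  expR (- (T%:R * (eta / 2) * a)) + expR (- (T%:R * (eta / 2) * a)) :> R by ring.
rewrite two; apply: lerD.
  apply: le_trans (ler_wpM2l (expR_ge0 _) hp) _.
  rewrite -expRD ler_expR /w le_eqVlt; apply/orP; left; apply/eqP; field; lra.
apply: le_trans (ler_wpM2l (expR_ge0 _) hm) _.
rewrite -expRD ler_expR /w le_eqVlt; apply/orP; left; apply/eqP; field; lra.
Qed.

End Concentration.
End SampleMean.

(** * Simulation with a value oracle for f *)

Lemma pr_output_ge0 (R : realType) (Query Answer Out : Type) (oracle : Query -> Answer)
  (E : set Out) (a : algorithm R Query Answer Out) : 0 <= pr_output oracle E a.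
Proof.
elim: a => [x|qs k IH|p k IH] //=.
by rewrite addr_ge0 ?mulr_ge0 ?IH// subr_ge0.
Qed.

Section Sampling.
Variables (R : realType) (n : nat).
Local Notation sets := {set 'I_n}.
Local Notation setalg := (algorithm R sets R 'cV[R]_n).

Lemma cube_point_coord (x : cube_point R n) i : (0 <= \val x i 0) && (\val x i 0 <= 1).
Proof. by have /forallP := valP x. Qed.

Definition coin (x : cube_point R n) i : {i01 R} :=
  Itv01 (elimTF andP (cube_point_coord x i)).1 (elimTF andP (cube_point_coord x i)).2.

Fixpoint flip_coords (x : cube_point R n) (s : seq 'I_n) (S : sets) (k : sets -> setalg) :=
  match s with
  | [::] => k S
  | i :: s' => Flip (coin x i) (fun b => flip_coords x s' (if b then i |: S else S) k)
  end.

Definition draw x k : setalg := flip_coords x (enum 'I_n) finset.set0 k.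

Fixpoint draws (T : nat) x (k : seq sets -> setalg) : setalg :=
  match T with
  | 0%N => k [::]
  | T'.+1 => draw x (fun S => draws T' x (fun s => k (S :: s)))
  end.

Definition query_point (qu : multilinear_query R n) : cube_point R n :=
  match qu with QueryValue x => x | QueryPartial x _ => x end.

(** All samples are drawn before any set is evaluated, so a round of queries to F costs a single
    round of queries to [f]. *)
Fixpoint draw_all (T : nat) (qs : seq (multilinear_query R n))
    (k : seq (seq sets) -> setalg) : setalg :=
  match qs with
  | [::] => k [::]
  | qu :: qs' => draws T (query_point qu) (fun b => draw_all T qs' (fun bs => k (b :: bs)))
  end.

Definition integrand (g : sets -> R) (qu : multilinear_query R n) : sets -> R :=
  match qu with QueryValue _ => g | QueryPartial _ i => marginal i g end.

Definition evaluations (qu : multilinear_query R n) (S : sets) : seq sets :=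
  match qu with QueryValue _ => [:: S] | QueryPartial _ i => [:: i |: S; S :\ i] end.

Fixpoint needed (qs : seq (multilinear_query R n)) (bs : seq (seq sets)) : seq sets :=
  match qs, bs with
  | qu :: qs', b :: bs' => flatten (map (evaluations qu) b) ++ needed qs' bs'
  | _, _ => [::]
  end.

Definition estimate (T : nat) (g : sets -> R) (qu : multilinear_query R n) (b : seq sets) : R :=
  (\sum_(S <- b) integrand g qu S) / T%:R.

Fixpoint estimates (T : nat) (g : sets -> R) (qs : seq (multilinear_query R n))
    (bs : seq (seq sets)) : seq R :=
  match qs, bs with
  | qu :: qs', b :: bs' => estimate T g qu b :: estimates T g qs' bs'
  | _, _ => [::]
  end.

Definition lookup (s : seq sets) (ans : seq R) (S : sets) : R := nth 0 ans (index S s).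

Fixpoint simulate (T : nat) (a : algorithm R (multilinear_query R n) R 'cV[R]_n) : setalg :=
  match a with
  | Output x => Output _ _ _ x
  | Round qs k =>
      draw_all T qs (fun bs => Round (needed qs bs)
        (fun ans => simulate T (k (estimates T (lookup (needed qs bs) ans) qs bs))))
  | Flip p k => Flip p (fun b => simulate T (k b))
  end.

Lemma eq_estimates T g g' qs bs :
  {in needed qs bs, g =1 g'} -> estimates T g qs bs = estimates T g' qs bs.
Proof.
elim: qs bs => [|qu qs IH] [|b bs] //= H; congr (_ :: _); last first.
  by apply: IH => S Sin; apply: H; rewrite mem_cat Sin orbT.
congr (_ / _); rewrite big_seq [RHS]big_seq; apply: eq_bigr => S Sb.
have gg' U : U \in evaluations qu S -> g U = g' U.
  move=> US; apply: H; rewrite mem_cat; apply/orP; left.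
  by apply/flatten_mapP; exists S.
case: qu gg' {H} => [x|x i] /= gg'; first by apply: gg'; rewrite inE.
by rewrite /marginal !gg' ?inE ?eqxx ?orbT.
Qed.

Lemma lookup_map g s : {in s, lookup s (map g s) =1 g}.
Proof.
by move=> S Ss; rewrite /lookup (nth_map S) ?index_mem// nth_index.
Qed.

(** * Worst-case costs of the simulation, for any cost that is maximized over coins *)

Section Costs.
Variable c : setalg -> nat.
Hypothesis cFlip : forall p k, c (Flip p k) = maxn (c (k true)) (c (k false)).

Lemma draw_cost x k N : (forall S, (c (k S) <= N)%N) -> (c (draw x k) <= N)%N.
Proof.
move=> H; rewrite /draw; elim: (enum _) finset.set0 => //= i s IH S.
by rewrite cFlip geq_max !IH.
Qed.

Lemma draws_cost T x k N : (forall s, size s = T -> (c (k s) <= N)%N) ->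
  (c (draws T x k) <= N)%N.
Proof.
elim: T k => [|T IH] k H /=; first exact: H.
by apply: draw_cost => S; apply: IH => s sT; apply: H; rewrite /= sT.
Qed.

Lemma draw_all_cost T qs k N :
  (forall bs, all (fun b => size b == T) bs -> (c (k bs) <= N)%N) ->
  (c (draw_all T qs k) <= N)%N.
Proof.
elim: qs k => [|qu qs IH] k H /=; first exact: H.
apply: draws_cost => b bT; apply: IH => bs bsT; apply: H.
by rewrite /= bT eqxx.
Qed.

End Costs.

Lemma size_needed T qs bs : all (fun b : seq sets => size b == T) bs ->
  (size (needed qs bs) <= 2 * T * size qs)%N.
Proof.
elim: qs bs => [|qu qs IH] [|b bs] //= /andP[/eqP bT bsT].
rewrite size_cat mulnS leq_add ?IH//.
rewrite -bT; elim: (b) => //= S b' IHb; rewrite size_cat mulnS leq_add//.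
by case: (qu).
Qed.

Variable f : sets -> R.

Lemma simulate_rounds T r Q a : bounded r Q a -> (rounds f (simulate T a) <= r)%N.
Proof.
elim: a r Q => [x|qs k IH|p k IH] r Q //=.
case: r => // r [_ H]; apply: draw_all_cost => // bs _ /=.
by rewrite ltnS; exact: IH (H _).
Qed.

Lemma simulate_queries T r Q a : bounded r Q a ->
  (queries f (simulate T a) <= 2 * T * Q)%N.
Proof.
elim: a r Q => [x|qs k IH|p k IH] r Q //=.
case: r => // r [sQ H]; apply: draw_all_cost => // bs bsT /=.
rewrite -(subnKC sQ) mulnDr leq_add ?size_needed//.
exact: IH (H _).
Qed.

(** * Success probability of the simulation *)

Section Probability.
Variable E : set 'cV[R]_n.
Local Notation pr := (pr_output f E).

(** Coordinates already tossed are 0 or 1, the others keep their probability; one more toss is the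
    affine expansion of the extension in that coordinate. *)
Lemma pr_flip_coords x s (S : sets) k : uniq s -> (forall i, i \in s -> i \notin S) ->
  pr (flip_coords x s S k) =
  multilinear (fun U => pr (k U)) (\col_j (if j \in s then \val x j 0 else (j \in S)%:R)).
Proof.
elim: s S => [|i s IH] S /=.
  move=> _ _; rewrite -(multilinear_indicator (fun U => pr (k U)) S).
  by congr multilinear; apply/matrixP => j l; rewrite !mxE.
move=> /andP[is_ us] sS.
have iS : i \notin S by apply: sS; rewrite mem_head.
have {}sS j : j \in s -> j \notin S by move=> js; apply: sS; rewrite inE js orbT.
rewrite !IH//; last first.
  by move=> j js; rewrite !inE negb_or sS// andbT; apply: contraNneq is_ => <-.
set y := (X in _ = multilinear _ X).
rewrite -[y](update_id y i) multilinear_update.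
have -> : y i 0 = \val x i 0 by rewrite !mxE inE eqxx.
rewrite (_ : update y i 1 = \col_j (if j \in s then \val x j 0 else (j \in i |: S)%:R)).
  rewrite (_ : update y i 0 = \col_j (if j \in s then \val x j 0 else (j \in S)%:R))//.
  apply/matrixP => j o; rewrite !mxE inE.
  by have [->|] := eqVneq j i; rewrite ?(negbTE is_) ?(negbTE iS).
apply/matrixP => j o; rewrite !mxE !inE.
by have [->|] := eqVneq j i; rewrite ?(negbTE is_).
Qed.

Lemma pr_draw x k : pr (draw x k) = multilinear (fun U => pr (k U)) (\val x).
Proof.
rewrite /draw pr_flip_coords ?enum_uniq//; last first.
  by move=> j _; rewrite inE.
by congr multilinear; apply/matrixP => j l; rewrite !mxE ord1 mem_enum.
Qed.

Lemma pr_draws T x k : pr (draws T x k) = mean (\val x) T (fun s => pr (k s)).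
Proof.
elim: T k => //= T IH k; rewrite pr_draw.
by congr multilinear; apply/funext => S; rewrite IH.
Qed.

Variables (ok : multilinear_query R n -> R -> Prop) (T : nat) (kappa : R).
Hypothesis kappa0 : 0 <= kappa.
Hypothesis estimate_fails : forall qu,
  mean (\val (query_point qu)) T (fun b => (~~ `[< ok qu (estimate T f qu b) >])%:R) <= kappa.

Lemma pr_draw_all qs k (v : R) : v <= 1 ->
  (forall bs, answers_ok ok qs (estimates T f qs bs) -> v <= pr (k bs)) ->
  v - kappa * (size qs)%:R <= pr (draw_all T qs k).
Proof.
move=> v1; elim: qs k => [|qu qs IH] k H /=.
  by rewrite mulr0 subr0; exact: (H [::]).
rewrite pr_draws; set x := \val _.
have xc : in_cube x by exact: valP.
apply: (@le_trans _ _ (mean x T (fun b => v - kappa * (size qs)%:R -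
    (~~ `[< ok qu (estimate T f qu b) >])%:R))).
  rewrite mean_cstB -natr1 mulrDr mulr1 opprD addrA lerD2l lerN2.
  exact: estimate_fails.
(* If this estimate fails, the target is at most v - 1 <= 0, so only successes matter. *)
apply: mean_le => // b; case: asboolP => okb /=; last first.
  apply: (@le_trans _ _ 0); last exact: pr_output_ge0.
  have : 0 <= kappa * (size qs)%:R by rewrite mulr_ge0.
  lra.
by rewrite subr0; apply: IH => bs okbs; exact: (H (b :: bs)).
Qed.

(** Each query uses fresh samples, so it fails with probability at most kappa whatever happened
    before; the union bound over Q queries thus survives adaptivity. *)
Lemma simulate_pr r Q a : bounded r Q a -> robust ok E a ->
  1 - kappa * Q%:R <= pr (simulate T a).
Proof.
elim: a r Q => [x|qs k IH|p k IH] r Q //=.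
  move=> _ Ex; rewrite indicE mem_set// gerBl mulr_ge0//.
case: r => // r [sQ H] rob.
have -> : 1 - kappa * Q%:R = 1 - kappa * (Q - size qs)%:R - kappa * (size qs)%:R :> R.
  by rewrite natrB//; ring.
apply: pr_draw_all; first by rewrite gerBl mulr_ge0.
move=> bs okbs /=; rewrite (@eq_estimates T _ f); last exact: lookup_map.
by apply: IH (H _) _; exact: rob.
Qed.

End Probability.
End Sampling.

(** * Choice of the constants *)

Lemma robust_sub (R : realType) (Query Answer Out : Type) (ok : Query -> Answer -> Prop)
  (E E' : set Out) (a : algorithm R Query Answer Out) :
  (E `<=` E')%classic -> robust ok E a -> robust ok E' a.
Proof.
move=> EE'; elim: a => [x|qs k IH|p k IH] //=; first exact: EE'.
by move=> H ans /H; exact: IH.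
Qed.

(** * Accuracy of exact answers and of sample means *)

Section Oracles.
Variables (R : realType) (n : nat) (f : {set 'I_n} -> R) (q : nat).
Hypotheses (n0 : (0 < n)%N) (q20 : (20 <= q)%N).
Hypotheses (fge0 : forall S, 0 <= f S).
Hypotheses (f0 : normalized f) (fm : monotone f) (fs : submodular f).

Lemma multilinear_oracleE qu :
  multilinear_oracle f qu = multilinear (integrand f qu) (\val (query_point qu)).
Proof. by case: qu => [x|x i] //=; exact: gradientE. Qed.

Lemma integrand_bounds qu S : 0 <= integrand f qu S <= query_range f qu.
Proof.
case: qu => [x|x i] /=.
  rewrite fge0; apply: le_trans (le_sum_singletons S fs f0 fm) _.
  apply: le_trans (ler_sum _ (fun j _ => singleton_le_max f j)) _.
  by rewrite sumr_const card_ord mulr_natl.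
rewrite marginal_ge0//; apply: le_trans (marginal_le_singleton i S fs f0) _.
exact: singleton_le_max.
Qed.

Lemma acceptable_exact qu : acceptable q f qu (multilinear_oracle f qu).
Proof.
rewrite /acceptable subrr normr0 addr_ge0 ?mulr_ge0 ?invr_ge0 ?ler0n//.
  rewrite multilinear_oracleE; apply: multilinear_ge0; first exact: valP.
  by move=> S; have /andP[] := integrand_bounds qu S.
by have /andP[+ /(le_trans _)] := integrand_bounds qu finset.set0 => + H; exact: H.
Qed.

(** The number of samples makes the Chernoff exponent T (eta/2) (eta/n) equal to z. *)
Lemma estimate_fails T z : T = (2 * n * q ^ 2 * z)%N -> (0 < z)%N -> forall qu,
  mean (\val (query_point qu)) T
    (fun b => (~~ `[< acceptable q f qu (estimate T f qu b) >])%:R) <=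
  2 * expR (- z%:R).
Proof.
move=> TE z0 qu.
have T0 : (0 < T)%N.
  have q0 : (0 < q)%N by exact: leq_trans q20.
  by rewrite TE !muln_gt0 n0 z0 q0.
have nR : 0 < n%:R :> R by rewrite ltr0n.
have qR : 0 < q%:R :> R by rewrite ltr0n (leq_trans _ q20).
have [e0 e1] := (eta_gt0 R q20, eta_le R q20).
have h0 S : 0 <= integrand f qu S by have /andP[] := integrand_bounds qu S.
have hB S : integrand f qu S <= query_range f qu by have /andP[] := integrand_bounds qu S.
have eta01 : 0 < (q%:R^-1 : R) <= 1 by rewrite e0 /=; lra.
have := @chernoff _ _ _ (valP (query_point qu)) _ _ _ (q%:R^-1 / n%:R) _ h0 hB eta01 T0.
have -> : T%:R * (q%:R^-1 / 2) * (q%:R^-1 / n%:R) = z%:R :> R.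
  by rewrite TE !natrM ?natrX; field; rewrite !lt0r_neq0.
apply: le_trans; apply: mean_le => [|b]; first exact: valP.
rewrite /acceptable -multilinear_oracleE -/(estimate T f qu b).
by case: asboolP => [->|/negP/negbTE ->].
Qed.

End Oracles.

Section Constants.
Variables (R : realType).
Implicit Types (eps : R) (n : nat).

Definition log_size n : nat := (trunc_log 2 n).+1.

Definition precision eps : nat := (Num.truncn (20 / eps)).+1.

Lemma ln2_ge : 2^-1 <= ln 2 :> R.
Proof.
rewrite -ler_expR lnK ?posrE//.
have h := expR_ge1Dx (- 2^-1 : R).
have h' : 2^-1 <= expR (- 2^-1) :> R by lra.
by rewrite -[leRHS]invrK -[leLHS]invrK lef_pV2 ?posrE ?invr_gt0 ?expR_gt0// -expRN.
Qed.

Lemma ln_ge_half n : (1 < n)%N -> 2^-1 <= ln n%:R :> R.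
Proof.
move=> n1; apply: le_trans ln2_ge _.
by rewrite ler_ln ?posrE ?ltr0n ?ler_nat// (ltn_trans _ n1).
Qed.

Lemma le_exp_log_size n : (n <= 2 ^ log_size n)%N.
Proof. by apply: ltnW; exact: trunc_log_ltn. Qed.

Lemma log_size_le n : (1 < n)%N -> (log_size n)%:R <= 4 * ln n%:R :> R.
Proof.
move=> n1; have n0 : (0 < n)%N by exact: ltn_trans n1.
have k0 : (0 < trunc_log 2 n)%N by apply: trunc_log_max.
set k := trunc_log 2 n in k0 *.
have H : ln 2 *+ k <= ln n%:R :> R.
  by rewrite -lnXn// ler_ln ?posrE ?exprn_gt0 ?ltr0n// -natrX ler_nat trunc_logP.
have : (log_size n)%:R <= 2 * k%:R :> R.
  by rewrite -natrM ler_nat /log_size -/k mul2n -addnn -addn1 leq_add2l.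
have : k%:R * 2^-1 <= k%:R * ln 2 :> R by rewrite ler_wpM2l// ln2_ge.
by move: H; rewrite -mulr_natl; lra.
Qed.

Lemma precision_ge eps : 0 < eps < 1 -> (20 <= precision eps)%N.
Proof.
move=> /andP[e0 e1]; rewrite -ltnS ltnS.
apply: leqW; rewrite truncn_ge_nat; last by rewrite divr_ge0// ltW.
by rewrite ler_pdivlMr//; lra.
Qed.

Lemma precision_inv eps : 0 < eps -> 20 * (precision eps)%:R^-1 <= eps.
Proof.
move=> e0; rewrite ler_pdivrMr ?ltr0n// mulrC -ler_pdivrMr//.
by apply: ltW; exact: truncnS_gt.
Qed.

Lemma precision_le eps : 0 < eps < 1 -> (precision eps)%:R <= 21 / eps.
Proof.
move=> /andP[e0 e1]; rewrite -[leLHS]natr1.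
have : (Num.truncn (20 / eps))%:R <= 20 / eps :> R by rewrite truncn_le// divr_ge0// ltW.
have : 1 <= eps^-1 by rewrite invf_ge1// ltW.
lra.
Qed.

(** N stands for l q; 22 is 18 for the probes, 3 for the final values and 1 for the first round. *)
Definition cost_factor (N : nat) : nat := 22 * N ^ 6.

(** The first term yields a power of 1/n as failure probability, the second offsets the number of
    queries in the union bound. *)
Definition samples_factor (d N : nat) : nat := d.+1 * N + 2 * cost_factor N.

Lemma greedy_queries_le n l q : (0 < n)%N -> (0 < l)%N -> (0 < q)%N ->
  (greedy_queries n l q <= n * cost_factor (l * q))%N.
Proof.
move=> n0 l0 q0; rewrite /greedy_queries /resolution /cost_factor.
set h := horizon l q; set N := (l * q)%N.
have N0 : (0 < N)%N by rewrite muln_gt0 l0.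
have lN : (l <= N)%N by rewrite leq_pmulr.
have qN : (q <= N)%N by rewrite leq_pmull.
have hN : (h <= 2 * N ^ 2)%N.
  rewrite mul2n -addnn /h /horizon leq_add//; first by rewrite -/N leq_pmulr.
  by rewrite -mulnn mulnA -/N leq_mul.
have l2 : (l.+2 <= 3 * N)%N by lia.
have D1 : ((h * q).+1 <= 3 * N ^ 3)%N.
  have : (h * q <= 2 * N ^ 2 * N)%N by exact: leq_mul.
  rewrite -mulnA -expnSr => H; have : (0 < N ^ 3)%N by rewrite expn_gt0 N0.
  lia.
have N6 : (N <= N ^ 6)%N by rewrite -{1}[N]expn1 leq_pexp2l.
have main : (h * (l.+2 * (h * q).+1 * n) <= 18 * N ^ 6 * n)%N.
  apply: (@leq_trans (2 * N ^ 2 * (3 * N * (3 * N ^ 3) * n))).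
    by rewrite !leq_mul.
  have -> : (N ^ 6 = N ^ 2 * N * N ^ 3)%N by rewrite -expnSr -expnD.
  by lia.
have nN6 : (n <= n * N ^ 6)%N by rewrite leq_pmulr// expn_gt0 N0.
have lN6 : (3 * N <= 3 * (n * N ^ 6))%N.
  by rewrite leq_mul2l /=; apply: leq_trans N6 _; rewrite leq_pmull.
lia.
Qed.

Lemma horizon_le l q : (0 < l)%N -> (1 < q)%N -> ((horizon l q).+2 <= 2 * (l * q ^ 2))%N.
Proof.
move=> l0 q1; rewrite /horizon mul2n -addnn -addSn -addSn leq_add2r.
have : (l * q * 2 <= l * q * q)%N by rewrite leq_mul.
have : (2 <= l * q)%N by apply: leq_trans q1 _; exact: leq_pmull.
by rewrite -mulnn mulnA; lia.
Qed.

Definition cost_poly : {poly R} := 22 *: ((13 *: 'X) ^+ 2) ^+ 6.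

Definition samples_poly (d : nat) : {poly R} :=
  4 *: (((13 *: 'X) ^+ 2) ^+ 2 * (d.+1%:R *: (13 *: 'X) ^+ 2 + 2 *: cost_poly) * cost_poly).

Lemma cost_polyE (t : R) : cost_poly.[t] = 22 * ((13 * t) ^+ 2) ^+ 6.
Proof. by rewrite /cost_poly !hornerE. Qed.

Lemma samples_polyE d (t : R) : (samples_poly d).[t] =
  4 * (((13 * t) ^+ 2) ^+ 2 * (d.+1%:R * (13 * t) ^+ 2 + 2 * cost_poly.[t]) * cost_poly.[t]).
Proof. by rewrite cost_polyE /samples_poly /cost_poly !hornerE. Qed.

Lemma cost_poly_ge0 (t : R) : 0 <= cost_poly.[t].
Proof. by rewrite cost_polyE mulr_ge0// exprn_ge0// sqr_ge0. Qed.

Lemma samples_poly_ge0 d (t : R) : 0 <= (samples_poly d).[t].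
Proof.
rewrite samples_polyE mulr_ge0// mulr_ge0 ?cost_poly_ge0//.
rewrite mulr_ge0 ?sqr_ge0// addr_ge0//; first by rewrite mulr_ge0 ?sqr_ge0.
by rewrite mulr_ge0 ?cost_poly_ge0.
Qed.

(** The factors 4 ln n and 21/eps give 84 ln n / eps; since ln n / eps >= 1/2, this is at most 168
    times its square, and 168 <= 13^2. *)
Lemma size_precision_le n eps : (1 < n)%N -> 0 < eps < 1 ->
  (log_size n * precision eps)%:R <= (13 * (ln n%:R / eps)) ^+ 2 :> R.
Proof.
move=> n1 e01; have [e0 e1] := andP e01.
have lh := ln_ge_half n1.
have lle := log_size_le n1; have ple := precision_le e01.
have i1 : 1 <= eps^-1 by rewrite invf_ge1// ltW.
rewrite natrM; apply: (@le_trans _ _ (4 * ln n%:R * (21 / eps))).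
  by apply: ler_pM.
have -> : (13 * (ln n%:R / eps)) ^+ 2 =
  4 * ln n%:R * (21 / eps) * (13 ^+ 2 / 84 * (ln n%:R * eps^-1)) by field; lra.
have p : 0 <= 4 * ln n%:R * (21 / eps).
  by rewrite !mulr_ge0 ?invr_ge0 ?(ltW e0)//; lra.
rewrite ler_peMr//.
have : 2^-1 * 1 <= ln n%:R * eps^-1 by apply: ler_pM.
lra.
Qed.

End Constants.

(** * Trivial cases and assembly of the final bounds *)

Section Assembly.
Variables (R : realType) (n m : nat) (A : 'M[R]_(m, n)) (eps : R) (f : {set 'I_n} -> R).
Hypotheses (pA : packing_matrix A) (eps0 : 0 < eps).
Hypotheses (fge0 : forall S, 0 <= f S).
Hypotheses (f0 : normalized f) (fm : monotone f) (fs : submodular f).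
Local Notation alpha := (approx_ratio eps).

Lemma approx_solutions_small : (n <= 1)%N -> approx_solutions f A alpha (const_mx 1).
Proof.
move=> n1.
have feas : feasible A (const_mx 1).
  apply/scaled_feasible1; split=> [i|j]; last by rewrite mxE lexx ler01.
  rewrite mxE; case: n n1 A pA => [|[|//]] _ A' [A1 _]; first by rewrite big_ord0.
  by rewrite big_ord1 mxE mulr1; have /andP[] := A1 i ord0.
split=> //.
have top : opt f A <= multilinear f (const_mx 1).
  apply: opt_le => y fy; apply: multilinear_monotone => //.
  - exact: feasible_cube fy.
  - exact: feasible_cube feas.
  - by move=> j; rewrite mxE; have /scaled_feasible1[_ /(_ j)/andP[]] := fy.
apply: le_trans top; rewrite ler_piMl ?opt_ge0// /approx_ratio.
have := eps0; have : 0 < 1 / expR 1 :> R by rewrite divr_gt0// expR_gt0.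
lra.
Qed.

Lemma approx_solutions_large : 1 <= eps -> approx_solutions f A alpha 0.
Proof.
move=> e1; split; first exact: feasible0.
rewrite (multilinear0 f0); apply: mulr_le0_ge0; last exact: opt_ge0.
have : 0 < 1 / expR 1 :> R by rewrite divr_gt0// expR_gt0.
by rewrite /approx_ratio; have := e1; lra.
Qed.

End Assembly.

(* When n <= 1 the bound on the queries is a constant that depends on neither m
   nor eps, and when eps is large the bound on the rounds is below 1. *)
Definition guarded (R : realType) (n : nat) (eps : R) (Query : Type)
    (a : algorithm R Query R 'cV[R]_n) : algorithm R Query R 'cV[R]_n :=
  if (n <= 1)%N then Output _ _ _ (const_mx 1)
  else if 1 <= eps then Output _ _ _ 0 else a.

Lemma guarded_ind (R : realType) (n m : nat) (A : 'M[R]_(m, n)) (eps : R)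
    (f : {set 'I_n} -> R) (Query : Type) (P : algorithm R Query R 'cV[R]_n -> Prop) a :
  packing_matrix A -> 0 < eps -> normalized f -> monotone f ->
  (forall x, approx_solutions f A (approx_ratio eps) x -> P (Output _ _ _ x)) ->
  ((1 < n)%N -> eps < 1 -> P a) -> P (guarded eps a).
Proof.
move=> pA e0 f0 fm Pout Pa; rewrite /guarded.
case: leqP => [n1|n1]; first exact/Pout/approx_solutions_small.
by case: leP => [e1|e1]; [exact/Pout/approx_solutions_large|exact: Pa].
Qed.

Lemma rounds_bound_ge0 (R : realType) (C eps : R) m n : 0 <= C -> 0 < eps ->
  0 <= rounds_bound C eps m n.
Proof.
move=> C0 e0; have ln0 k : 0 <= ln (maxn 2 k)%:R :> R.
  by rewrite ln_ge0// ler1n leq_max.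
rewrite mulr_ge0// mulr_ge0// mulr_ge0 ?exprn_ge0//.
by rewrite divr_ge0// exprn_ge0// ltW.
Qed.

(** The horizon is O(log n / eps^2); eps < 1 and ln(max(2,m))^2 >= 1/4 pass to the stated form, with
    constant 2 * 4 * 21^2 * 4 = 14112 <= 120^2. *)
Lemma horizon_rounds_bound (R : realType) (eps : R) m n : (1 < n)%N -> 0 < eps < 1 ->
  (horizon (log_size n) (precision eps)).+2%:R <= rounds_bound (120 ^+ 2) eps m n.
Proof.
move=> n1 e01; have [e0 e1] := andP e01.
have q20 := precision_ge e01.
have := @horizon_le (log_size n) (precision eps) isT (leq_trans _ q20).
move=> /(_ isT); rewrite -(ler_nat R) natrM => /le_trans; apply.
rewrite /rounds_bound (maxn_idPr n1).
have lm : 2^-1 <= ln (maxn 2 m)%:R :> R by apply: ln_ge_half; rewrite leq_max.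
have lm2 : 4^-1 <= ln (maxn 2 m)%:R ^+ 2 :> R.
  have : 2^-1 * 2^-1 <= ln (maxn 2 m)%:R * ln (maxn 2 m)%:R :> R by apply: ler_pM.
  by rewrite expr2; lra.
have lh := ln_ge_half R n1.
have lle := log_size_le R n1; have ple := precision_le e01.
have ei : 1 <= eps^-1 by rewrite invf_ge1// ltW.
have q2 : (precision eps ^ 2)%:R <= 21 ^+ 2 * eps^-1 ^+ 2.
  rewrite natrX; have -> : 21 ^+ 2 * eps^-1 ^+ 2 = (21 / eps) ^+ 2 by ring.
  by apply: lerXn2r; rewrite ?nnegrE ?divr_ge0 ?(ltW e0).
have q4 : eps^-1 ^+ 2 <= 1 / eps ^+ 4.
  by rewrite div1r -exprVn ler_weXn2l.
have h1 : (log_size n * precision eps ^ 2)%:R <= 4 * ln n%:R * (21 ^+ 2 * (1 / eps ^+ 4)) :> R.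
  rewrite natrM; apply: ler_pM => //; apply: le_trans q2 _.
  by rewrite ler_wpM2l// exprn_ge0.
have p0 : 0 <= 1 / eps ^+ 4 by rewrite divr_ge0// exprn_ge0// ltW.
have h2 : 1 / eps ^+ 4 * 4^-1 * ln n%:R <= 1 / eps ^+ 4 * ln (maxn 2 m)%:R ^+ 2 * ln n%:R.
  by rewrite ler_wpM2r ?ler_wpM2l//; lra.
have h3 : 0 <= 1 / eps ^+ 4 * 4^-1 * ln n%:R by rewrite !mulr_ge0//; lra.
lra.
Qed.

Lemma cost_factor_le (R : realType) n (eps : R) : (1 < n)%N -> 0 < eps < 1 ->
  (cost_factor (log_size n * precision eps))%:R <= (cost_poly R).[ln n%:R / eps].
Proof.
move=> n1 e01; rewrite cost_polyE natrM ler_pM2l// natrX.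
by apply: lerXn2r; rewrite ?nnegrE ?sqr_ge0// size_precision_le.
Qed.

Lemma greedy_good (R : realType) n m (A : 'M[R]_(m, n)) (eps : R) f : 0 < eps ->
  monotone f -> normalized f ->
  (good A (precision eps) f `<=` approx_solutions f A (approx_ratio eps))%classic.
Proof.
move=> e0 fm f0 x [fx Fx]; split=> //; apply: le_trans Fx.
rewrite ler_wpM2r ?opt_ge0// /approx_ratio div1r lerB//.
exact: precision_inv.
Qed.

Definition multilinear_algorithm (R : realType) n m (A : 'M[R]_(m, n)) (eps : R) :=
  guarded eps (greedy A (log_size n) (precision eps)).

Definition sample_size (R : realType) (d n : nat) (eps : R) : nat :=
  2 * n * precision eps ^ 2 * samples_factor d (log_size n * precision eps).

Definition sampling_algorithm (R : realType) (d n m : nat) (A : 'M[R]_(m, n)) (eps : R) :=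
  guarded eps (simulate (sample_size d n eps) (greedy A (log_size n) (precision eps))).

Lemma samples_le (R : realType) (d n : nat) (eps : R) : (1 < n)%N -> 0 < eps < 1 ->
  (2 * sample_size d n eps * (n * cost_factor (log_size n * precision eps)))%:R <=
  n%:R ^+ 2 * (samples_poly R d).[ln n%:R / eps].
Proof.
move=> n1 e01; have cf := cost_factor_le n1 e01.
have N := size_precision_le n1 e01.
rewrite samples_polyE /sample_size /samples_factor.
set L := log_size n; set q := precision eps in cf N *.
set W := (cost_poly R).[_] in cf *.
set Y := (13 * _) ^+ 2 in N *.
set w := cost_factor (L * q) in cf *; clearbody w.
have Y0 : 0 <= Y by apply: le_trans N.
have -> : (2 * (2 * n * q ^ 2 * (d.+1 * (L * q) + 2 * w)) * (n * w) =
  n ^ 2 * (4 * (q ^ 2 * (d.+1 * (L * q) + 2 * w) * w)))%N by rewrite -!mulnn; lia.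
rewrite natrM natrX ler_pM2l ?exprn_gt0 ?ltr0n ?(ltn_trans _ n1)//.
rewrite natrM ler_pM2l// natrM; apply: ler_pM => //.
rewrite natrM; apply: ler_pM => //.
  rewrite natrX; apply: lerXn2r; rewrite ?nnegrE//; apply: le_trans N.
  by rewrite ler_nat leq_pmull.
rewrite natrD !natrM; apply: lerD; first by rewrite ler_wpM2l// -natrM.
by rewrite ler_pM2l.
Qed.

(** Here e^((d+1) l) >= n^(d+1) absorbs the factor n and leaves n^(-d), while e^(2w) >= 2w absorbs
    the factor 2w. *)
Lemma failure_le (R : realType) (d n l w : nat) : (0 < n)%N -> (n <= 2 ^ l)%N ->
  (0 < w)%N ->
  2 * expR (- (d.+1 * l + 2 * w)%:R) * (n * w)%:R <= n%:R ^- d :> R.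
Proof.
move=> n0 nl w0; have nR : 0 < n%:R :> R by rewrite ltr0n.
have wR : 0 < w%:R :> R by rewrite ltr0n.
have h1 : n%:R ^+ d.+1 <= expR (d.+1 * l)%:R :> R.
  rewrite natrM expRM_natl; apply: lerXn2r; rewrite ?nnegrE ?expR_ge0//.
  exact: expR_ge_nat.
have h2 : 2 * w%:R <= expR (2 * w)%:R :> R.
  by have := expR_ge1Dx ((2 * w)%:R : R); rewrite natrM; lra.
rewrite expRN natrD expRD.
have pos : 0 < n%:R ^+ d.+1 * (2 * w%:R) :> R by rewrite !mulr_gt0 ?exprn_gt0.
have : (expR (d.+1 * l)%:R * expR (2 * w)%:R)^-1 <= (n%:R ^+ d.+1 * (2 * w%:R))^-1 :> R.
  rewrite lef_pV2 ?posrE ?mulr_gt0 ?expR_gt0 ?exprn_gt0//.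
  by apply: ler_pM => //; rewrite ?exprn_ge0 ?mulr_ge0.
move=> h3; have -> : n%:R ^- d = 2 * (n%:R ^+ d.+1 * (2 * w%:R))^-1 * (n * w)%:R :> R.
  by rewrite natrM exprS; field; rewrite expf_neq0 ?lt0r_neq0.
by rewrite ler_wpM2r// ler_pM2l.
Qed.

Theorem theorem1p1 (R : realType) :
  exists C : R,
    (exists (p : {poly R})
            (alg : forall n m : nat, 'M[R]_(m, n) -> R ->
                     algorithm R (multilinear_query R n) R 'cV[R]_n),
       forall (n m : nat) (A : 'M[R]_(m, n)) (eps : R) (f : {set 'I_n} -> R),
         packing_matrix A -> 0 < eps ->
         (forall S, 0 <= f S) -> normalized f -> monotone f -> submodular f ->
         let a := alg n m A eps in
         let oracle := multilinear_oracle f in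
         [/\ deterministic a,
             pr_output oracle (approx_solutions f A (approx_ratio eps)) a = 1,
             (rounds oracle a)%:R <= rounds_bound C eps m n
           & (queries oracle a)%:R <= n%:R * p.[ln n%:R / eps]])
    /\
    (forall d : nat,
     exists (p : {poly R})
            (alg : forall n m : nat, 'M[R]_(m, n) -> R ->
                     algorithm R {set 'I_n} R 'cV[R]_n),
       forall (n m : nat) (A : 'M[R]_(m, n)) (eps : R) (f : {set 'I_n} -> R),
         packing_matrix A -> 0 < eps ->
         (forall S, 0 <= f S) -> normalized f -> monotone f -> submodular f ->
         let a := alg n m A eps in
         [/\ 1 - n%:R ^- d <=
               pr_output f (approx_solutions f A (approx_ratio eps)) a,
             (rounds f a)%:R <= rounds_bound C eps m n
           & (queries f a)%:R <= n%:R ^+ 2 * p.[ln n%:R / eps]]).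
Proof.
exists (120 ^+ 2); split.
  exists (cost_poly R), (@multilinear_algorithm R) => n m A eps f pA e0 fge0 f0 fm fs a oracle.
  rewrite /a /multilinear_algorithm.
  elim/(@guarded_ind R n m A eps f): (guarded _ _) => // [x xa|n1 e1].
    split=> //=; first by rewrite indicE mem_set.
      exact: rounds_bound_ge0.
    by rewrite mulr_ge0// cost_poly_ge0.
  have e01 : 0 < eps < 1 by rewrite e0.
  have n0 := ltn_trans (isT : (0 < 1)%N) n1.
  have q20 := precision_ge e01.
  have bnd := greedy_bounded A (log_size n) (precision eps).
  split.
  - exact: bounded_deterministic bnd.
  (* Exact answers are acceptable, so robustness yields success with probability 1. *)
  - apply: (@robust_exact _ _ _ _ (acceptable (precision eps) f)).
      by move=> qu; exact: acceptable_exact.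
    apply: robust_sub (greedy_good (A := A) e0 fm f0) _.
    by apply: greedy_robust => //; exact: le_exp_log_size.
  - apply: le_trans (horizon_rounds_bound m n1 e01).
    by rewrite ler_nat; exact: bounded_rounds bnd.
  - apply: le_trans (ler_wpM2l _ (cost_factor_le n1 e01)) => //.
    rewrite -natrM ler_nat; apply: leq_trans (bounded_queries _ bnd) _.
    by apply: greedy_queries_le => //; exact: leq_trans q20.
move=> d; exists (samples_poly R d), (@sampling_algorithm R d) => n m A eps f pA e0 fge0 f0 fm fs a.
rewrite /a /sampling_algorithm.
elim/(@guarded_ind R n m A eps f): (guarded _ _) => // [x xa|n1 e1].
  split=> /=.
  - by rewrite indicE mem_set// gerBl invr_ge0 exprn_ge0.
  - exact: rounds_bound_ge0.
  - by rewrite mulr_ge0 ?exprn_ge0// samples_poly_ge0.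
have e01 : 0 < eps < 1 by rewrite e0.
have n0 := ltn_trans (isT : (0 < 1)%N) n1.
have q20 := precision_ge e01.
have q0 : (0 < precision eps)%N by [].
have bnd := greedy_bounded A (log_size n) (precision eps).
have gq := @greedy_queries_le n (log_size n) (precision eps) n0 isT q0.
have w0 : (0 < cost_factor (log_size n * precision eps))%N.
  by rewrite muln_gt0 expn_gt0 muln_gt0 q0.
set w := cost_factor _ in gq w0.
have z0 : (0 < samples_factor d (log_size n * precision eps))%N.
  by rewrite addn_gt0 !muln_gt0 q0.
split.
- have rob : robust (acceptable (precision eps) f)
      (approx_solutions f A (approx_ratio eps)) (greedy A (log_size n) (precision eps)).
    apply: robust_sub (greedy_good (A := A) e0 fm f0) _.
    by apply: greedy_robust => //; exact: le_exp_log_size.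
  have fails := @estimate_fails R n f (precision eps) n0 q20 fge0 f0 fm fs
    (sample_size d n eps) _ erefl z0.
  have k0 : 0 <= 2 * expR (- (samples_factor d (log_size n * precision eps))%:R) :> R.
    by rewrite mulr_ge0// expR_ge0.
  apply: le_trans (simulate_pr k0 fails bnd rob).
  rewrite lerD2l lerN2.
  (* The sample count is expressed through l q, so l q takes the place of l; n <= 2^(l q) still
     holds. *)
  apply: le_trans (failure_le R d n0 (_ : (n <= 2 ^ (log_size n * precision eps))%N) w0).
    by apply: ler_wpM2l => //; rewrite ler_nat.
  apply: leq_trans (le_exp_log_size n) _.
  by rewrite leq_exp2l// leq_pmulr.
- apply: le_trans (horizon_rounds_bound m n1 e01).
  by rewrite ler_nat; exact: simulate_rounds bnd.
- apply: le_trans (samples_le d n1 e01).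
  rewrite ler_nat; apply: leq_trans (simulate_queries f _ bnd) _.
  by rewrite leq_mul2l gq orbT.
Qed.
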